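(* The maximum partial composition ordering problem and the maximum total composition ordering problem, when all input functions are monotone nondecreasing linear functions $f_i(x)=a_ix+b_i$ with $a_i\ge 0$ ($i\in[n]$), are both solvable in $O(n\log n)$ time.
   Context: Let $[n]=\{1,\dots,n\}$. Given real functions $f_1,\dots,f_n:\mathbb{R}\to\mathbb{R}$ and a constant $c\in\mathbb{R}$, the maximum total composition ordering problem asks for a permutation $\sigma:[n]\to[n]$ maximizing $f_{\sigma(n)}\circ f_{\sigma(n-1)}\circ\dots\circ f_{\sigma(1)}(c)$. The maximum partial composition ordering problem asks for a permutation $\sigma:[n]\to[n]$ and an integer $k$ with $0\le k\le n$ maximizing $f_{\sigma(k)}\circ\dots\circ f_{\sigma(1)}(c)$ (for $k=0$ the value is $c$). *)

(* Defs.v *)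
From mathcomp Require Import all_boot all_order all_algebra all_fingroup.
From mathcomp Require Import boolp classical_sets reals topology normedtype.
From mathcomp Require Import landau sequences exp.

Set Implicit Arguments.
Unset Strict Implicit.
Unset Printing Implicit Defensive.

Import Order.TTheory GRing.Theory Num.Theory.
Import numFieldNormedType.Exports.
Local Open Scope classical_set_scope.
Local Open Scope ring_scope.

(** * Composition ordering problems

    The index set [n] is ['I_n], so everything is numbered from 0. *)

Section CompositionOrdering.
Variables (R : realType) (n : nat).
Implicit Types (f : 'I_n -> R -> R) (s : 'S_n) (c : R).

(* [comp_value f s k c] is f_{s(k)} o ... o f_{s(1)} (c): since [enum 'I_n] is
   increasing, the fold applies f_{s(1)} first.  The full composition is the
   case k = n. *)
Definition comp_value f s (k : nat) c : R :=
  foldl (fun x i => f (s i) x) c (take k (enum 'I_n)).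

Definition optimal_total f c s : Prop :=
  forall s', comp_value f s' n c <= comp_value f s n c.

Definition optimal_partial f c s (k : nat) : Prop :=
  (k <= n)%N /\
  forall s' (k' : nat), (k' <= n)%N -> comp_value f s' k' c <= comp_value f s k c.

End CompositionOrdering.

(** * Real RAM

    Programs are built from assignments, conditionals and loops over a memory
    made of integer arrays (holding natural numbers) and real arrays, the x-th
    array being an infinite sequence of cells; a program mentions only finitely
    many arrays.  A scalar variable is cell 0 of an array.  Real cells hold exact
    reals, and indirect addressing is by integers only: there is no conversion
    between reals and integers, in particular no floor. *)

Inductive nexp : Type :=
  | NConst of nat
  | NGet of nat & nexp
  | NAdd of nexp & nexp
  | NSub of nexp & nexp.

Inductive rexp : Type :=
  | RZero
  | ROne
  | RGet of nat & nexp
  | RAdd of rexp & rexp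
  | RSub of rexp & rexp
  | RMul of rexp & rexp
  | RDiv of rexp & rexp.

Inductive bexp : Type :=
  | NLe of nexp & nexp
  | RLe of rexp & rexp
  | BNot of bexp
  | BAnd of bexp & bexp.

(* [NSet x i e] stores [e] in cell [i] of the integer array [x]; [RSet] is the
   same for real arrays. *)
Inductive cmd : Type :=
  | Skip
  | NSet of nat & nexp & nexp
  | RSet of nat & nexp & rexp
  | Seq of cmd & cmd
  | If of bexp & cmd & cmd
  | While of bexp & cmd.

(* Every operation, comparison, constant and memory access costs one unit. *)

Fixpoint ncost (e : nexp) : nat :=
  match e with
  | NConst _ => 1
  | NGet _ e1 => (ncost e1).+1
  | NAdd e1 e2 | NSub e1 e2 => (ncost e1 + ncost e2).+1
  end.

Fixpoint rcost (e : rexp) : nat :=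
  match e with
  | RZero | ROne => 1
  | RGet _ i => (ncost i).+1
  | RAdd e1 e2 | RSub e1 e2 | RMul e1 e2 | RDiv e1 e2 => (rcost e1 + rcost e2).+1
  end.

Fixpoint bcost (e : bexp) : nat :=
  match e with
  | NLe e1 e2 => (ncost e1 + ncost e2).+1
  | RLe e1 e2 => (rcost e1 + rcost e2).+1
  | BNot e1 => (bcost e1).+1
  | BAnd e1 e2 => (bcost e1 + bcost e2).+1
  end.

Section Semantics.
Variable R : realType.

Record store : Type := Store {
  nmem : nat -> nat -> nat;
  rmem : nat -> nat -> R }.

Definition update (V : Type) (m : nat -> nat -> V) (x i : nat) (v : V) :
    nat -> nat -> V :=
  fun y j => if (y == x) && (j == i) then v else m y j.

(* Integer subtraction is truncated at 0, and division of reals by 0 gives 0. *)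
Fixpoint neval (st : store) (e : nexp) : nat :=
  match e with
  | NConst k => k
  | NGet x i => nmem st x (neval st i)
  | NAdd e1 e2 => (neval st e1 + neval st e2)%N
  | NSub e1 e2 => (neval st e1 - neval st e2)%N
  end.

Fixpoint reval (st : store) (e : rexp) : R :=
  match e with
  | RZero => 0
  | ROne => 1
  | RGet x i => rmem st x (neval st i)
  | RAdd e1 e2 => reval st e1 + reval st e2
  | RSub e1 e2 => reval st e1 - reval st e2
  | RMul e1 e2 => reval st e1 * reval st e2
  | RDiv e1 e2 => reval st e1 / reval st e2
  end.

Fixpoint beval (st : store) (e : bexp) : bool :=
  match e with
  | NLe e1 e2 => (neval st e1 <= neval st e2)%N
  | RLe e1 e2 => reval st e1 <= reval st e2
  | BNot e1 => ~~ beval st e1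
  | BAnd e1 e2 => beval st e1 && beval st e2
  end.

(* [exec p st t st']: started in [st], the program [p] halts after [t] units of
   time in [st'].  The rules are deterministic. *)
Inductive exec : cmd -> store -> nat -> store -> Prop :=
  | exec_skip st : exec Skip st 1 st
  | exec_nset x i e st :
      exec (NSet x i e) st (ncost i + ncost e).+1
        (Store (update (nmem st) x (neval st i) (neval st e)) (rmem st))
  | exec_rset x i e st :
      exec (RSet x i e) st (ncost i + rcost e).+1
        (Store (nmem st) (update (rmem st) x (neval st i) (reval st e)))
  | exec_seq p q st t st1 u st2 :
      exec p st t st1 -> exec q st1 u st2 -> exec (Seq p q) st (t + u) st2
  | exec_if_true b p q st t st1 :
      beval st b -> exec p st t st1 -> exec (If b p q) st (bcost b + t).+1 st1
  | exec_if_false b p q st t st1 :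
      ~~ beval st b -> exec q st t st1 -> exec (If b p q) st (bcost b + t).+1 st1
  | exec_while_true b p st t st1 u st2 :
      beval st b -> exec p st t st1 -> exec (While b p) st1 u st2 ->
      exec (While b p) st (bcost b + t + u).+1 st2
  | exec_while_false b p st :
      ~~ beval st b -> exec (While b p) st (bcost b).+1 st.

(* A problem with instances [I] is solvable in time O(g) if a single program
   halts with a correct answer on every valid instance, within a worst-case time
   [T] that depends on the size only and satisfies T(n) = O(g(n)) as n tends to
   infinity. *)
Definition solvable_in_time (I : Type) (size : I -> nat) (load : I -> store)
    (valid : I -> Prop) (answer : I -> store -> Prop) (g : nat -> R) : Prop :=
  exists (p : cmd) (T : nat -> nat),
    (fun n => (T n)%:R : R) =O_\oo g /\
    forall x : I, valid x ->
      exists (t : nat) (st : store),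
        [/\ exec p (load x) t st, (t <= T (size x))%N & answer x st].

End Semantics.

(** * The problems for linear functions *)

Section LinearOrdering.
Variable R : realType.

Record instance : Type := Instance {
  arity : nat;
  slope : 'I_arity -> R;
  intercept : 'I_arity -> R;
  start : R }.

Definition linear_fun (x : instance) (i : 'I_(arity x)) (y : R) : R :=
  slope i * y + intercept i.

Definition nondecreasing_slopes (x : instance) : Prop :=
  forall i : 'I_(arity x), 0 <= slope i.

Definition cells (n : nat) (v : 'I_n -> R) (i : nat) : R :=
  if insub i is Some j then v j else 0.

(* Input: n is in cell 0 of integer array 0, the slopes and the intercepts are
   in real arrays 0 and 1, and the constant c is in cell 0 of real array 2; all
   other cells are 0. *)
Definition load_instance (x : instance) : store R :=
  Store
    (fun y j => if (y == 0%N) && (j == 0%N) then arity x else 0%N)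
    (fun y j =>
       if y == 0%N then cells (@slope x) j
       else if y == 1%N then cells (@intercept x) j
       else if (y == 2%N) && (j == 0%N) then start x
       else 0).

(* Output: the permutation is listed in integer array 1 and, for the partial
   problem, k is in cell 0 of integer array 2. *)
Definition stores_perm (n : nat) (st : store R) (s : 'S_n) : Prop :=
  forall i : 'I_n, nmem st 1 i = s i.

Definition answer_total (x : instance) (st : store R) : Prop :=
  exists s : 'S_(arity x),
    stores_perm st s /\ optimal_total (@linear_fun x) (start x) s.

Definition answer_partial (x : instance) (st : store R) : Prop :=
  exists s : 'S_(arity x),
    stores_perm st s /\
    optimal_partial (@linear_fun x) (start x) s (nmem st 2 0).

Definition n_log_n (n : nat) : R := n%:R * ln n%:R.

End LinearOrdering.

(* Main.v *)
Require Import Defs.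
From mathcomp Require Import all_boot all_order all_algebra all_fingroup.
From mathcomp Require Import reals.
From mathcomp Require Import zify ring lra.

(** Attach to f_i(x) = a_i x + b_i the vector v_i = (1 - a_i, b_i). A composition
    f_Y o f_X has vector v_Y + a_Y v_X, and exchanging two adjacent blocks X and Y
    changes the value by a nonnegative multiple of det(v_X, v_Y), so everything is
    governed by the cyclic order of the v_i by angle.

    Partial problem: replace f_i by max(x, f_i(x)). For these functions the order
    by angle, cut at the downward direction, is pairwise optimal, hence optimal by
    adjacent exchanges; the greedy choice along it realises the maxima.

    Total problem: some rotation of the order by angle is optimal. Take an optimal
    order with vector V and cut the circle at -V (if V = 0, first rotate so that
    all prefixes have slope at most 1, and cut at (0, -1)). Optimality under block
    exchanges puts the vectors of all prefixes on the right of V and those of all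
    suffixes on its left, and this excludes every adjacent inversion that could
    not be exchanged without loss. All n rotations are evaluated in linear time
    from the prefix and suffix compositions.

    The vectors are sorted by a rational pseudo-angle with a tournament tree. *)

Set Implicit Arguments.
Unset Strict Implicit.
Unset Printing Implicit Defensive.

Import Order.TTheory GRing.Theory Num.Theory.
Local Open Scope ring_scope.

(** * Pseudo-angles *)

Section Angle.
Variable R : realFieldType.
Implicit Types x y k : R.

Definition det x y x' y' : R := x * y' - y * x'.

(* Position on the diamond |x| + |y| = 1, in (-1, 3] and increasing
   counterclockwise from the downward direction; opposite points differ by 2.
   The zero vector gets 4. *)
Definition angle x y : R :=
  let s := `|x| + `|y| in
  if s <= 0 then 4 else if x <= 0 then 2 - y / s else y / s.

(** Inverse of [angle] on the diamond: [k < 1] runs over the right half, at height [k], and [k >= 1]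
    over the left half, at height [2 - k]. *)
Definition diamond_x k : R := if k < 1 then 1 - `|k| else `|k - 2| - 1.
Definition diamond_y k : R := if k < 1 then k else 2 - k.

Lemma angleP x y : (x != 0) || (y != 0) ->
  [/\ -1 < angle x y, angle x y <= 3 &
      exists2 s, 0 < s &
        x = s * diamond_x (angle x y) /\ y = s * diamond_y (angle x y)].
Proof.
move=> nz; rewrite /angle; set s := _ + _.
have s_gt0 : 0 < s.
  by rewrite lt_neqAle eq_sym paddr_eq0 // !normr_eq0 negb_and nz addr_ge0.
rewrite leNgt s_gt0 /=.
have yE : y = s * (y / s) by rewrite mulrC divfK // gt_eqF.
have xE : `|x| = s * (1 - `|y / s|).
  by rewrite mulrBr -{2}(gtr0_norm s_gt0) -normrM -yE mulr1 /s addrK.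
have t_le1 : `|y / s| <= 1.
  by have := normr_ge0 x; rewrite xE pmulr_rge0 // subr_ge0.
move: (y / s) yE xE t_le1 => t yE xE; rewrite ler_norml => /andP[t_geN1 t_le1].
case: (leP x 0) => hx.
  split; [lra|lra|exists s => //].
  rewrite /diamond_x /diamond_y ltNge.
  have -> /= : 1 <= 2 - t by lra.
  have -> : 2 - t - 2 = - t by ring.
  rewrite normrN; split; last by rewrite yE; ring.
  by move: xE; rewrite ler0_norm // => xE; rewrite -[LHS]opprK xE; ring.
have lt_t1 : `|t| < 1.
  by have := hx; rewrite -[x]gtr0_norm // xE pmulr_rgt0 // subr_gt0.
move: (lt_t1); rewrite ltr_norml => /andP[h1 h2].
split; [lra|lra|exists s => //].
by rewrite /diamond_x /diamond_y h2 -xE gtr0_norm.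
Qed.

(** A difference of 2 is a half turn, where the determinant changes sign; the half-open range keeps
    the difference below the full turn 4. Weak and strict forms are separate because [D] vanishes at
    differences 0 and 2. *)
Lemma det_diamond k k' : -1 < k -> k <= k' -> k' <= 3 ->
  let D := det (diamond_x k) (diamond_y k) (diamond_x k') (diamond_y k') in
  [/\ k' - k <= 2 -> 0 <= D, 2 < k' - k -> D < 0,
      2 <= k' - k -> D <= 0 & 0 < k' - k < 2 -> 0 < D].
Proof.
move=> h1 h2 h3 /=; rewrite /diamond_x /diamond_y /det.
case: (ltP k 1) => hk; case: (ltP k' 1) => hk'; try lra.
- by case: (ler0P k) => ?; case: (ler0P k') => ?; split=> *; nra.
- case: (ler0P k) => ?; case: (ler0P (k' - 2)) => ?; split=> *; try nra.
- case: (ler0P (k - 2)) => ?; case: (ler0P (k' - 2)) => ?; split=> *; try nra.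
  by case: (ltP 1 k) => ?; nra.
Qed.

Lemma det_angle x y x' y' : (x != 0) || (y != 0) -> (x' != 0) || (y' != 0) ->
  angle x y <= angle x' y' ->
  let t := angle x' y' - angle x y in
  [/\ t <= 2 -> 0 <= det x y x' y', 2 < t -> det x y x' y' < 0,
      2 <= t -> det x y x' y' <= 0 & 0 < t < 2 -> 0 < det x y x' y'].
Proof.
move=> nz nz' le /=; have [h1 h2 [s s_gt0 [ex ey]]] := angleP nz.
have [h1' h2' [s' s'_gt0 [ex' ey']]] := angleP nz'.
have [c1 c2 c3 c4] := det_diamond h1 le h2'.
move: (angle x y) (angle x' y') ex ey ex' ey' c1 c2 c3 c4 {nz nz' h1 h1' h2 h2' le}.
move=> k k' -> -> -> ->.
have -> : det (s * diamond_x k) (s * diamond_y k) (s' * diamond_x k') (s' * diamond_y k')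
  = (s * s') * det (diamond_x k) (diamond_y k) (diamond_x k') (diamond_y k').
  by rewrite /det; ring.
have ss_gt0 : 0 < s * s' by rewrite mulr_gt0.
by rewrite !(pmulr_rge0 _ ss_gt0) (pmulr_rlt0 _ ss_gt0) (pmulr_rle0 _ ss_gt0) (pmulr_rgt0 _ ss_gt0).
Qed.

Lemma angle_inj x y x' y' : (x != 0) || (y != 0) -> (x' != 0) || (y' != 0) ->
  angle x y = angle x' y' -> exists2 t, 0 < t & x = t * x' /\ y = t * y'.
Proof.
move=> nz nz' eq; have [_ _ [s s_gt0 [ex ey]]] := angleP nz.
have [_ _ [s' s'_gt0 [ex' ey']]] := angleP nz'.
exists (s / s'); first by rewrite divr_gt0.
rewrite -eq in ex' ey'; move: (angle x y) ex ey ex' ey' {eq nz nz'} => k -> -> -> ->.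
by rewrite !mulrA divfK ?gt_eqF.
Qed.

Lemma angle00 : angle 0 0 = 4 :> R.
Proof. by rewrite /angle normr0 addr0 lexx. Qed.

Lemma detC x y x' y' : det x y x' y' = - det x' y' x y.
Proof. by rewrite /det; ring. Qed.

(* The premise says that, turning counterclockwise from the direction e, one
   meets (x, y) no later than (x', y'). *)
Lemma det_cut e1 e2 x y x' y' : (e1 != 0) || (e2 != 0) ->
  let ke := angle e1 e2 in let k := angle x y in let k' := angle x' y' in
  [|| ke <= k <= k', k <= k' < ke | k' < ke <= k] ->
  [/\ 0 <= det x y x' y' \/
        (0 < det e1 e2 x y \/ k = ke) /\ det e1 e2 x' y' < 0,
      k' = ke -> k = ke &
      det e1 e2 x y < 0 -> det e1 e2 x' y' <= 0].
Proof.
move=> nze /=; have [e_gt e_le _] := angleP nze.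
(* The zero vector has pseudo-angle 4, beyond every direction, and all its determinants vanish. *)
case: (boolP ((x != 0) || (y != 0))) => [nz|]; last first.
  rewrite negb_or !negbK => /andP[/eqP-> /eqP->]; rewrite angle00 => hk.
  have nz' : angle x' y' != angle e1 e2.
    apply/eqP => ek; rewrite ek in hk.
    by case/or3P: hk => /andP[]; lra.
  split; [left; rewrite /det; lra | by move/eqP: nz' | by rewrite /det; lra].
case: (boolP ((x' != 0) || (y' != 0))) => [nz'|]; last first.
  rewrite negb_or !negbK => /andP[/eqP-> /eqP->]; rewrite angle00 => hk.
  split; [left; rewrite /det; lra | by lra | by rewrite /det; lra].
have [h1 h2 _] := angleP nz; have [h1' h2' _] := angleP nz'.
have A := det_angle nze nz; have B := det_angle nze nz'; have C := det_angle nz nz'.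
have A' := det_angle nz nze; have B' := det_angle nz' nze; have C' := det_angle nz' nz.
rewrite ![det _ _ e1 e2]detC ![det x' y' x y]detC in A' B' C'.
move: (angle e1 e2) (angle x y) (angle x' y') e_gt e_le h1 h2 h1' h2' A B C A' B' C'.
move: (det e1 e2 x y) (det e1 e2 x' y') (det x y x' y') => {nze nz nz'}.
move=> dx dx' dxx ke k k' e_gt e_le h1 h2 h1' h2' A B C A' B' C'.
(* Relative to the cut [ke], both angles lie after it, both before it, or the first after and the
   second before. *)
case/or3P => /andP[l1 l2].
- have [A1 A2 A3 A4] := A l1; have [B1 B2 B3 B4] := B (le_trans l1 l2).
  have [C1 C2 C3 C4] := C l2.
  split; [|lra|].
    case: (lerP (k' - k) 2) => hd; [left; exact: C1|right]; split; last by apply: B2; lra.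
    case: (eqVneq k ke) => [|ne]; [by right|left; apply: A4].
    have : ke < k by rewrite lt_neqAle eq_sym ne.
    by move=> ?; apply/andP; split; lra.
  move=> hx; have : ~~ (k - ke <= 2) by apply/negP => /A1; lra.
  by rewrite -ltNge => ?; apply: B3; lra.
- have [A1 A2 A3 A4] := A' (le_trans l1 (ltW l2)); have [B1 B2 B3 B4] := B' (ltW l2).
  have [C1 C2 C3 C4] := C l1.
  split; [|lra|].
    case: (lerP (k' - k) 2) => hd; [left; exact: C1|right]; split.
      by left; rewrite -oppr_lt0; apply: A2; lra.
    by rewrite -oppr_gt0; apply: B4; apply/andP; split; lra.
  move=> hx; have : ~~ (2 <= ke - k) by apply/negP => /A3; lra.
  by rewrite -ltNge => ?; rewrite -oppr_ge0; apply: B1; lra.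
- have [A1 A2 A3 A4] := A l2; have [B1 B2 B3 B4] := B' (ltW l1).
  have [C1 C2 C3 C4] := C' (ltW (lt_le_trans l1 l2)).
  split; [|lra|].
    case: (lerP 2 (k - k')) => hd; [left; rewrite -oppr_le0; exact: C3|right]; split.
      case: (eqVneq k ke) => [|ne]; [by right|left; apply: A4].
      have : ke < k by rewrite lt_neqAle eq_sym ne.
      by move=> ?; apply/andP; split; lra.
    by rewrite -oppr_gt0; apply: B4; apply/andP; split; lra.
  move=> hx; have : ~~ (k - ke <= 2) by apply/negP => /A1; lra.
  by rewrite -ltNge => ?; rewrite -oppr_ge0; apply: B1; lra.
Qed.

End Angle.

(** * Exchange arguments for the total problem *)

Section SeqFacts.

Lemma exists_seq_argmax (R : realDomainType) (U : eqType) (F : U -> R) (s : seq U) :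
  s != [::] -> exists2 x, x \in s & forall y, y \in s -> F y <= F x.
Proof.
elim: s => // x [|y s] IH _.
  by exists x; rewrite ?mem_head // => z; rewrite inE => /eqP->.
have [//|z zs zmax] := IH.
case: (leP (F x) (F z)) => hxz.
  exists z; first by rewrite inE zs orbT.
  by move=> t; rewrite inE => /predU1P[->|/zmax].
exists x; first by rewrite mem_head.
by move=> t; rewrite inE => /predU1P[->//|/zmax /le_trans]; apply; apply: ltW.
Qed.

Lemma not_sorted_split (U : Type) (r : rel U) (s : seq U) : ~~ sorted r s ->
  exists p x y q, s = p ++ x :: y :: q /\ ~~ r x y.
Proof.
elim: s => // x [|y s] IH //=.
rewrite negb_and => /orP[nr|/IH [p [z [t [q [-> ntz]]]]]].
  by exists [::], x, y, s.
by exists (x :: p), z, t, q.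
Qed.

(** The lists of positions in [t] are both sorted and permutations of each other, hence equal, and
    positions determine entries. *)
Lemma sorted_index_eq (U : eqType) (s t : seq U) : uniq t -> perm_eq s t ->
  sorted (relpre (index^~ t) leq) s -> s = t.
Proof.
move=> ut pst ss.
have map_idx : map (index^~ t) t = iota 0 (size t).
  case: t ut {pst ss} => // x t ut; apply: (@eq_from_nth _ 0%N).
    by rewrite size_map size_iota.
  move=> i; rewrite size_map => ilt.
  by rewrite (nth_map x) // index_uniq // nth_iota.
have E : map (index^~ t) s = map (index^~ t) t.
  apply: (sorted_eq leq_trans anti_leq); first by rewrite sorted_map.
    by rewrite map_idx iota_sorted.
  exact: perm_map.
have inj : {in [pred u | all (mem t) u] &, injective (map (index^~ t))}.
  by apply: inj_in_map => x y xt yt exy; rewrite -(nth_index x xt) exy nth_index.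
apply: inj E; rewrite inE; last exact/allP.
by apply/allP => x; rewrite (perm_mem pst).
Qed.

End SeqFacts.

(** * Compositions of linear functions and exchanges of adjacent blocks *)

Section Composition.
Variables (R : realFieldType) (T : eqType) (a b : T -> R).
Hypothesis a_ge0 : forall i, 0 <= a i.
Implicit Types (l P Q X Y : seq T) (i j : T).

Definition lin (x : R) (i : T) : R := a i * x + b i.
Definition lin_seq (x : R) (l : seq T) : R := foldl lin x l.
Definition scale l : R := \prod_(i <- l) a i.
Definition shift l : R := lin_seq 0 l.

Lemma lin_seqE x l : lin_seq x l = scale l * x + shift l.
Proof.
rewrite /shift /scale; elim: l x => [|i l IH] x /=.
  by rewrite big_nil mul1r addr0.
rewrite big_cons IH [in RHS]IH /lin; ring.
Qed.

Lemma scale_cat X Y : scale (X ++ Y) = scale X * scale Y.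
Proof. exact: big_cat. Qed.

Lemma scale_cons i l : scale (i :: l) = a i * scale l.
Proof. exact: big_cons. Qed.

Lemma scale_nil : scale [::] = 1.
Proof. exact: big_nil. Qed.

Lemma scale_ge0 l : 0 <= scale l.
Proof. exact: prodr_ge0. Qed.

Lemma shift_cat X Y : shift (X ++ Y) = scale Y * shift X + shift Y.
Proof. by rewrite {1}/shift /lin_seq foldl_cat -/(lin_seq _ _) lin_seqE. Qed.

Lemma shift_cons i l : shift (i :: l) = scale l * b i + shift l.
Proof. by rewrite -cat1s shift_cat /shift /= /lin mulr0 add0r. Qed.

Lemma shift_nil : shift [::] = 0. Proof. by []. Qed.

Definition seqE := (shift_cat, shift_cons, shift_nil, scale_cat, scale_cons, scale_nil).

Lemma perm_scale X Y : perm_eq X Y -> scale X = scale Y.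
Proof. exact: perm_big. Qed.

(* v_X = (1 - scale X, shift X); vdet d X = det(d, v_X) and bdet X Y = det(v_X, v_Y). *)
Definition vdet (d1 d2 : R) X : R := det d1 d2 (1 - scale X) (shift X).
Definition bdet X Y : R := vdet (1 - scale X) (shift X) Y.

Lemma vdetE d1 d2 X : vdet d1 d2 X = d1 * shift X - d2 * (1 - scale X).
Proof. by []. Qed.

Lemma bdetE X Y :
  bdet X Y = (1 - scale X) * shift Y - shift X * (1 - scale Y).
Proof. by []. Qed.

Lemma bdetC X Y : bdet X Y = - bdet Y X.
Proof. rewrite !bdetE; ring. Qed.

Lemma scale1 i : scale [:: i] = a i.
Proof. by rewrite scale_cons scale_nil mulr1. Qed.

Lemma shift1 i : shift [:: i] = b i.
Proof. by rewrite shift_cons scale_nil mul1r shift_nil addr0. Qed.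

(** [X ++ Y] and [Y ++ X] have the same slope, so [P] contributes equally to both; their constant
    terms differ by [bdet X Y], which [Q] multiplies by its slope. *)
Lemma bdet_swap P X Y Q :
  shift (P ++ X ++ Y ++ Q) - shift (P ++ Y ++ X ++ Q) = scale Q * bdet X Y.
Proof. rewrite !bdetE !seqE; ring. Qed.

Section Max.
Variable rho : seq T.

(** All rearrangements of [rho] have the same slope, so maximising [shift] maximises the value at
    every starting point. *)
Definition optimal l :=
  perm_eq l rho /\ forall l', perm_eq l' rho -> shift l' <= shift l.

Lemma optimal_swap P X Y Q : optimal (P ++ X ++ Y ++ Q) -> 0 <= scale Q * bdet X Y.
Proof.
move=> [pl mx]; rewrite -(bdet_swap P) subr_ge0; apply: mx.
by apply: perm_trans pl; rewrite perm_cat2l !catA perm_cat2r perm_catC.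
Qed.

Lemma optimal_swapW P X Y Q : optimal (P ++ X ++ Y ++ Q) ->
  scale Q * bdet X Y <= 0 -> optimal (P ++ Y ++ X ++ Q).
Proof.
move=> [pl mx]; rewrite -(bdet_swap P) subr_le0 => le; split.
  by apply: perm_trans pl; rewrite perm_cat2l !catA perm_cat2r perm_catC.
by move=> l' /mx /le_trans; apply.
Qed.

(* Cramer's rule gives the vectors of i :: Q and P ++ [:: j] in the basis v_j, v_i;
   the sign hypotheses force all four coordinates to vanish, and then
   bdet P [:: j; i] < 0 contradicts optimality. *)
Lemma no_inversion d1 d2 P j i Q :
  optimal (P ++ j :: i :: Q) -> 0 < scale Q -> bdet [:: i] [:: j] < 0 ->
  vdet d1 d2 [:: i] < 0 -> 0 < vdet d1 d2 [:: j] ->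
  vdet d1 d2 (P ++ [:: j]) <= 0 -> 0 <= vdet d1 d2 (i :: Q) -> False.
Proof.
move=> opt q_gt0 ij hi hj hPj hiQ.
(* [c1] to [c5] express optimality against five exchanges of adjacent blocks. *)
have c1 : 0 <= bdet [:: i] Q.
  by have := @optimal_swap (P ++ [:: j]) [:: i] Q [::]; rewrite -catA cats0 scale_nil mul1r; apply.
have c2 : 0 <= bdet [:: j] (i :: Q).
  by have := @optimal_swap P [:: j] (i :: Q) [::]; rewrite cats0 scale_nil mul1r; apply.
have c3 : 0 <= scale (i :: Q) * bdet P [:: j] by apply: (@optimal_swap [::]).
have c4 : 0 <= bdet (P ++ [:: j]) [:: i].
  by rewrite -(pmulr_rge0 _ q_gt0); apply: (@optimal_swap [::]); rewrite /= -catA.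
have c5 : 0 <= bdet P [:: j; i].
  by rewrite -(pmulr_rge0 _ q_gt0); apply: (@optimal_swap [::]).
move: (a_ge0 i) (a_ge0 j) q_gt0 ij hi hj hPj hiQ c1 c2 c3 c4 c5.
rewrite !bdetE !vdetE !seqE !mulr1 ?mul1r ?addr0.
move: (a i) (a j) (b i) (b j) (scale P) (shift P) (scale Q) (shift Q).
move=> ai aj bi bj p s q t ai0 aj0 q_gt0 ij hi hj hPj hiQ c1 c2 c3 c4 c5.
(* [D], [K] and [H] are - det(v_i, v_j), - det(d, v_i) and det(d, v_j), all positive. The vector of
   [i :: Q] is [(x, y)], and [u], [v] are the determinants of v_i and v_j with it. *)
set D := bi * (1 - aj) - (1 - ai) * bj.
have D_gt0 : 0 < D by rewrite /D; lra.
set K := - (d1 * bi - d2 * (1 - ai)); set H := d1 * bj - d2 * (1 - aj).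
set x := 1 - ai * q; set y := q * bi + t.
set u := (1 - ai) * y - bi * x; set v := (1 - aj) * y - bj * x.
have u0 : 0 <= u by move: c1; rewrite /u /x /y; lra.
have v0 : 0 <= v by exact: c2.
have E1 : D * (d1 * y - d2 * x) = - (u * H + v * K) by rewrite /D /u /v /H /K; ring.
have uv0 : u * H + v * K <= 0 by rewrite -oppr_ge0 -E1 mulr_ge0 // ltW.
have K_gt0 : 0 < K by rewrite /K oppr_gt0.
have uH : 0 <= u * H by rewrite mulr_ge0 // ltW.
have vK : 0 <= v * K by rewrite mulr_ge0 // ltW.
have /eqP : u * H = 0 by lra.
rewrite mulf_eq0 (gt_eqF hj) orbF => /eqP u_0.
have /eqP : v * K = 0 by lra.
rewrite mulf_eq0 (gt_eqF K_gt0) orbF => /eqP v_0.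
have /eqP : D * x = 0.
  have -> : D * x = v * (1 - ai) - u * (1 - aj) by rewrite /D /u /v; ring.
  by rewrite u_0 v_0 !mul0r subr0.
rewrite mulf_eq0 (gt_eqF D_gt0) /= => /eqP x_0.
(* The slope of [i :: Q] is 1, so [c3] loses its factor. The same argument now applies to the vector
   [(X, Y)] of [P ++ [:: j]]. *)
have aiq : ai * q = 1 by move: x_0; rewrite /x; lra.
rewrite aiq mul1r in c3.
set X := 1 - p * aj; set Y := aj * s + bj.
set U := X * bi - Y * (1 - ai); set V := X * bj - Y * (1 - aj).
have U0 : 0 <= U by exact: c4.
have V0 : 0 <= V by have := mulr_ge0 aj0 c3; rewrite /V /X /Y; lra.
have E2 : D * (d1 * Y - d2 * X) = U * H + V * K by rewrite /D /U /V /H /K; ring.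
have UV0 : U * H + V * K <= 0 by rewrite -E2 pmulr_rle0.
have UH : 0 <= U * H by rewrite mulr_ge0 // ltW.
have VK : 0 <= V * K by rewrite mulr_ge0 // ltW.
have /eqP : U * H = 0 by lra.
rewrite mulf_eq0 (gt_eqF hj) orbF => /eqP U_0.
have /eqP : V * K = 0 by lra.
rewrite mulf_eq0 (gt_eqF K_gt0) orbF => /eqP V_0.
have := mulr_ge0 aj0 c5.
(* The factor after [aj] is [bdet P [:: j; i]]; with [U] and [V] zero the product is [- D], which is
   negative. *)
suff -> : aj * ((1 - p) * (ai * bj + bi) - s * (1 - aj * ai)) = U + ai * V - D.
  by rewrite U_0 V_0; lra.
rewrite /U /V /D /X /Y; ring.
Qed.

End Max.
End Composition.

(** * Reaching a prescribed order by exchanges that lose nothing *)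

Section Descent.
Variables (R : realFieldType) (T : eqType) (a b : T -> R).
Hypothesis a_ge0 : forall i, 0 <= a i.
(* E holds for the functions whose vector is opposite to d: the strict signs needed
   by no_inversion fail for them, but moving them to the front costs nothing. *)
Variables (rho : seq T) (E : pred T) (d1 d2 : R).
Hypothesis uniq_rho : uniq rho.

Local Notation shift := (shift a b).
Local Notation scale := (scale a).
Local Notation bdet := (bdet a b).
Local Notation vdet := (vdet a b d1 d2).
Local Notation optimal := (optimal a b rho).
Local Notation before i j := (index i rho < index j rho)%N.

Hypothesis rho_det : forall i j, i \in rho -> j \in rho -> before i j ->
  0 <= bdet [:: i] [:: j] \/
  (vdet [:: i] < 0 \/ E i) /\ 0 < vdet [:: j].
Hypothesis rho_E : forall i j, i \in rho -> j \in rho -> before i j -> E j -> E i.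
Hypothesis E_opp : forall i, i \in rho -> E i ->
  exists2 t, 0 <= t & 1 - a i = - t * d1 /\ b i = - t * d2.

(* Optimality alone when the total vector is nonzero; when it vanishes, good also
   remembers that prefixes have slope at most 1. *)
Variable good : seq T -> Prop.
Hypothesis good_optimal : forall l, good l -> optimal l.
Hypothesis good_prefix : forall P Q, good (P ++ Q) -> vdet P <= 0 /\ 0 <= vdet Q.
Hypothesis good_swap : forall P i j Q, i \in rho -> j \in rho -> before i j ->
  good (P ++ j :: i :: Q) -> optimal (P ++ i :: j :: Q) -> good (P ++ i :: j :: Q).
Hypothesis good_front : forall P i Q, i \in rho -> E i ->
  good (P ++ i :: Q) -> optimal (i :: P ++ Q) -> good (i :: P ++ Q).

(* The offset outweighs all inversions created inside E by a move to the front. *)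
Let rank x := (index x rho + if E x then 0 else size rho * size rho)%N.
(** Each entry's rank is weighted by the number of entries from it to the end, so [mu] drops when an
    adjacent pair with the larger rank first is swapped. *)
Let mu := fix mu l := if l is x :: l' then (size l * rank x + mu l')%N else 0%N.

Let mu_cat X Y : mu (X ++ Y) = (mu X + size Y * sumn (map rank X) + mu Y)%N.
Proof. by elim: X => [|x X IH] /=; [lia | rewrite IH size_cat; lia]. Qed.

(** Induction on [mu]. An adjacent inversion is swapped when this costs nothing; otherwise
    [no_inversion] excludes it, unless its second element lies in [E], and then that element moves
    to the front. *)
Lemma descent l : good l -> optimal rho.
Proof.
have [k] := ubnP (mu l); elim: k l => // k IH l; rewrite ltnS => lek gl.
have [pl _] := good_optimal gl.
case sl: (sorted (relpre (index^~ rho) leq) l).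
  by move: (good_optimal gl); rewrite (sorted_index_eq uniq_rho pl sl).
have [P [j [i [Q [El]]]]] := not_sorted_split (negbT sl).
rewrite /= -ltnNge => ltij; rewrite {l}El in lek gl pl sl.
have jr : j \in rho by rewrite -(perm_mem pl) mem_cat mem_head orbT.
have ir : i \in rho by rewrite -(perm_mem pl) mem_cat !inE eqxx !orbT.
have opt := good_optimal gl.
have swap : scale Q * bdet [:: j] [:: i] <= 0 -> optimal rho.
  move=> le0; have opt' := @optimal_swapW _ _ _ _ _ P [:: j] [:: i] Q opt le0.
  apply: IH (good_swap ir jr ltij gl opt').
  apply: leq_trans lek; rewrite !mu_cat /= ltn_add2l.
  have : (rank i < rank j)%N.
    rewrite /rank; have := rho_E ir jr ltij.
    case: (E j) => [->//|_]; first lia.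
    by case: (E i); lia.
  by lia.
have s_ge0 : 0 <= scale Q by exact: scale_ge0.
case: (leP (bdet [:: j] [:: i]) 0) => [le0|ji_gt0].
  by apply: swap; rewrite mulr_ge0_le0.
move: s_ge0; rewrite le_eqVlt => /predU1P[s0|s_gt0].
  by apply: swap; rewrite -s0 mul0r.
have ij_lt0 : bdet [:: i] [:: j] < 0 by rewrite bdetC oppr_lt0.
have [|[hEi hj]] := rho_det ir jr ltij; first by rewrite leNgt ij_lt0.
have [hPj hiQ] : vdet (P ++ [:: j]) <= 0 /\ 0 <= vdet (i :: Q).
  by apply: good_prefix; rewrite -catA.
case: hEi => [hi|Ei].
  by case: (no_inversion a_ge0 opt s_gt0 ij_lt0 hi hj hPj hiQ).
have nEj : E j = false.
  apply/negP => /(E_opp jr)[t _ [e1 e2]]; move: hj.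
  by rewrite vdetE scale1 shift1 e1 e2; lra.
(* Since v_i is a nonpositive multiple of d, the sign of [vdet] on the prefix [P ++ [:: j]] makes
   the move lossless. *)
have opt' : optimal (i :: (P ++ [:: j]) ++ Q).
  have := @optimal_swapW _ _ a b rho [::] (P ++ [:: j]) [:: i] Q.
  rewrite /= -!catA /=; apply => //.
  rewrite mulr_ge0_le0 ?(ltW s_gt0) // bdetC oppr_le0.
  have [t t_ge0 [e1 e2]] := E_opp ir Ei.
  have -> : bdet [:: i] (P ++ [:: j]) = - t * vdet (P ++ [:: j]).
    by rewrite bdetE vdetE scale1 shift1 e1 e2; ring.
  by rewrite mulNr oppr_ge0 mulr_ge0_le0.
have /IH : good (i :: (P ++ [:: j]) ++ Q).
  by apply: good_front => //; rewrite -catA.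
apply; apply: leq_trans lek.
(* Moving [i] forward adds [(size P).+1 * index i rho], less than the square of the size, while [j]
   loses one copy of its rank, at least that square. *)
rewrite -catA /= !mu_cat /= !size_cat /=.
have -> : rank i = index i rho by rewrite /rank Ei addn0.
have : (size rho * size rho <= rank j)%N by rewrite /rank nEj leq_addl.
move: (rank j) => rj le_rj.
have lt_i : (index i rho < size rho)%N by rewrite index_mem.
have le_P : (size P < size rho)%N.
  by rewrite -(perm_size pl) size_cat /= addnS ltnS leq_addr.
have lt_Pi : ((size P).+1 * index i rho < size rho * size rho)%N.
  by apply: leq_ltn_trans (_ : (size rho * index i rho < _)%N);
    rewrite ?leq_mul2r ?le_P ?orbT // ltn_mul2l lt_i (leq_ltn_trans _ lt_i).
move: (mu P) (mu Q) (sumn _) (size P) (size Q) (index i rho) (size rho * size rho)%N lt_Pi le_rj.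
clear; lia.
Qed.

End Descent.

(** This makes a cut of the list sorted by angle a rotation of that list. *)
Lemma sorted_filter_split (U : Type) (r : rel U) (p : pred U) (s : seq U) :
  transitive r -> (forall x y, r x y -> p y -> p x) -> sorted r s ->
  s = filter p s ++ filter (predC p) s.
Proof.
move=> r_tr down; elim: s => //= x s IH srt.
have {}IH := IH (path_sorted srt).
case px: (p x) => /=; first by rewrite -IH.
have np : all (predC p) s.
  apply: sub_all (order_path_min r_tr srt) => y rxy /=.
  by apply: contraFN px; apply: down.
have /all_filterP -> := np; suff -> : filter p s = [::] by [].
by apply: size0nil; apply/eqP; rewrite size_filter -leqn0 leqNgt -has_count -all_predC np.
Qed.

(** * Cutting the circle of angles: some rotation is optimal *)

Section Rotation.
Variables (R : realFieldType) (T : eqType) (a b : T -> R).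
Hypothesis a_ge0 : forall i, 0 <= a i.
Variable tau : seq T.
Hypothesis uniq_tau : uniq tau.

Local Notation shift := (shift a b).
Local Notation scale := (scale a).
Local Notation bdet := (bdet a b).
Local Notation optimal := (optimal a b).

Definition key i : R := angle (1 - a i) (b i).

Hypothesis sorted_tau : sorted (relpre key <=%R) tau.

Lemma exists_optimal : exists l, optimal tau l.
Proof.
have : permutations tau != [::].
  by apply/eqP => e; have := mem_permutations tau tau; rewrite perm_refl e.
move=> /(exists_seq_argmax shift)[l]; rewrite mem_permutations => pl mx.
by exists l; split=> // l' pl'; apply: mx; rewrite mem_permutations.
Qed.

Lemma optimal_perm s t l : perm_eq s t -> optimal s l -> optimal t l.
Proof.
move=> pst [pl mx]; split; first exact: perm_trans pl pst.
by move=> l' pl'; apply: mx; apply: perm_trans pl' _; rewrite perm_sym.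
Qed.

Section Cut.
Variables d1 d2 : R.
Hypothesis nzd : (d1 != 0) || (d2 != 0).

Let ke := angle (- d1) (- d2).
(** The circular order by angle, read counterclockwise from the direction of -d. *)
Let rho := filter (predC (fun i => key i < ke)) tau ++ filter (fun i => key i < ke) tau.

Let perm_rho : perm_eq rho tau.
Proof. by rewrite perm_catC; apply: permEl; apply: perm_filterC. Qed.

Let rot_rho : exists m, rho = rot m tau.
Proof.
exists (size (filter (fun i => key i < ke) tau)).
rewrite [X in rot _ X](@sorted_filter_split _ _ (fun i => key i < ke) _ _ _ sorted_tau).
- by rewrite rot_size_cat.
- by move=> x y z /=; apply: le_trans.
- by move=> x y /=; apply: le_lt_trans.
Qed.

Let rho_cut i j : i \in rho -> j \in rho -> (index i rho < index j rho)%N ->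
  [|| ke <= key i <= key j, key i <= key j < ke | key j < ke <= key i].
Proof.
have tr : transitive (relpre key <=%R) by move=> x y z /=; apply: le_trans.
have idx p : i \in filter p tau -> j \in filter p tau ->
    (index i (filter p tau) < index j (filter p tau))%N -> key i <= key j.
  move=> ii jj; apply: (sorted_ltn_index tr) ii jj.
  exact: sorted_filter.
rewrite /rho !mem_cat !index_cat.
set F1 := filter (predC _) tau; set F2 := filter _ tau.
have inF1 x : x \in F1 -> ke <= key x by rewrite mem_filter /= -leNgt => /andP[].
have inF2 x : x \in F2 -> key x < ke by rewrite mem_filter => /andP[].
case: (boolP (i \in F1)) => i1 /=; case: (boolP (j \in F1)) => j1 /=.
- by move=> _ _ /(idx _ i1 j1) ->; rewrite inF1.
- by move=> _ j2 _; rewrite (inF2 j) // inF1 // !orbT.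
- by move=> _ _; rewrite ltnNge (leq_trans _ (leq_addr _ _)) // index_size.
- by move=> i2 j2; rewrite ltn_add2l => /(idx _ i2 j2) ->; rewrite (inF2 j) ?orbT.
Qed.

Variable good : seq T -> Prop.
Hypothesis good_optimal : forall l, good l -> optimal tau l.
Hypothesis good_prefix : forall P Q, good (P ++ Q) ->
  vdet a b d1 d2 P <= 0 /\ 0 <= vdet a b d1 d2 Q.
Hypothesis good_swap : forall P i j Q,
  (0 < vdet a b d1 d2 [:: i] -> 0 <= vdet a b d1 d2 [:: j]) ->
  good (P ++ j :: i :: Q) -> optimal tau (P ++ i :: j :: Q) -> good (P ++ i :: j :: Q).
Hypothesis good_front : forall P i Q, vdet a b d1 d2 [:: i] = 0 ->
  good (P ++ i :: Q) -> optimal tau (i :: P ++ Q) -> good (i :: P ++ Q).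

Let nze : (- d1 != 0) || (- d2 != 0). Proof. by rewrite !oppr_eq0. Qed.

Let E_opp i : key i = ke ->
  exists2 t, 0 <= t & 1 - a i = - t * d1 /\ b i = - t * d2.
Proof.
move=> ki; have nzi : (1 - a i != 0) || (b i != 0).
  apply: contraPT ki; rewrite negb_or !negbK => /andP[/eqP e1 /eqP e2].
  rewrite /key e1 e2 angle00 => e4; have [_] := angleP nze.
  by rewrite -/ke -e4; lra.
have [t /ltW t_ge0 [e1 e2]] := angle_inj nzi nze ki.
by exists t => //; rewrite e1 e2 !mulrN !mulNr.
Qed.

Let vdet1 i : vdet a b d1 d2 [:: i] = - det (- d1) (- d2) (1 - a i) (b i).
Proof. by rewrite vdetE scale1 shift1 /det; ring. Qed.

(** Descent towards [rho], with [E] the functions pointing exactly along -d, where [det_cut] gives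
    no strict sign. *)
Lemma optimal_cut l : good l -> exists m, optimal tau (rot m tau).
Proof.
move=> gl; have [m em] := rot_rho; exists m; rewrite -em.
apply: optimal_perm perm_rho _.
have opt l' : good l' -> optimal rho l'.
  by move/good_optimal; apply: optimal_perm; rewrite perm_sym.
have cut i j (ir : i \in rho) (jr : j \in rho) h := det_cut nze (rho_cut ir jr h).
apply: (@descent _ _ a b a_ge0 rho [pred i | key i == ke] d1 d2 _ _ _ _ good opt _ _ _ l gl).
- by rewrite (perm_uniq perm_rho).
- move=> i j ir jr h; have [c1 c2 c3] := cut i j ir jr h.
  rewrite bdetE !scale1 !shift1 !vdet1 oppr_lt0 oppr_gt0 /=.
  by case: c1 => [c|[[c|c] c']]; [left|right; split; [left|]|right; split; [right; apply/eqP|]].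
- move=> i j ir jr h /eqP kj; have [c1 c2 c3] := cut i j ir jr h.
  by apply/eqP; apply: c2.
- by move=> i _ /eqP; exact: E_opp.
- exact: good_prefix.
- move=> P i j Q ir jr h gji oij; apply: good_swap => //; last exact: optimal_perm perm_rho oij.
  have [c1 c2 c3] := cut i j ir jr h.
  by rewrite !vdet1 oppr_gt0 oppr_ge0.
- move=> P i Q ir /eqP /E_opp [t _ [e1 e2]] g o; apply: good_front g _.
    by rewrite vdetE scale1 shift1 e1 e2; ring.
  exact: optimal_perm perm_rho o.
Qed.

End Cut.

Lemma optimal_rotation : exists m, optimal tau (rot m tau).
Proof.
have [l0 o0] := exists_optimal.
set d1 := 1 - scale l0; set d2 := shift l0.
have scale_opt l : optimal tau l -> scale l = scale l0.
  by move=> [pl _]; apply: perm_scale; rewrite (permPl pl) perm_sym; case: o0.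
have shift_opt l : optimal tau l -> shift l = shift l0.
  move=> [pl mx]; case: o0 => [pl0 mx0]; apply/eqP.
  by rewrite eq_le mx0 // mx.
case: (boolP ((d1 != 0) || (d2 != 0))) => [nzd|].
  apply: (@optimal_cut d1 d2 nzd (optimal tau)) o0 => // P Q o.
  (* From V = v_Q + a_Q v_P one gets det(V, v_P) = - [bdet P Q] and det(V, v_Q) = a_Q [bdet P Q];
     exchanging [P] and [Q] gives [bdet P Q >= 0]. *)
  have := @optimal_swap _ _ a b tau [::] P Q [::].
  rewrite /= cats0 scale_nil mul1r => /(_ o) PQ.
  rewrite !vdetE /d1 /d2 -(scale_opt _ o) -(shift_opt _ o) !seqE.
  split.
    by move: PQ; rewrite bdetE; nra.
  have := mulr_ge0 (scale_ge0 a_ge0 Q) PQ; rewrite bdetE; nra.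
rewrite negb_or !negbK /d1 /d2 => /andP[/eqP d1_0 /eqP d2_0].
have A1 : scale l0 = 1 by lra.
(* Here V = 0, so the optimal composition is the identity. For d = (0, 1), [vdet] is the slope minus
   1; prefix slopes at most 1 force suffix slopes at least 1, as they multiply to 1. *)
pose good l := optimal tau l /\ forall k, scale (take k l) <= 1.
have nzd : ((0 : R) != 0) || ((1 : R) != 0) by rewrite oner_neq0 orbT.
have v01 X : vdet a b 0 1 X = scale X - 1 by rewrite vdetE; ring.
(* Starting just after a prefix of maximal slope brings all prefix slopes to at most 1. *)
have [X [Y [eXY mx]]] : exists X Y, l0 = X ++ Y /\
    forall k, scale (take k l0) <= scale X.
  have [//|m _ mx] := @exists_seq_argmax R _ (fun m => scale (take m l0)) (iota 0 (size l0).+1).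
  exists (take m l0), (drop m l0); rewrite cat_take_drop; split=> // k.
  case: (leqP k (size l0)) => [kle|/ltnW/take_oversize->].
    by apply: mx; rewrite mem_iota.
  by rewrite -[in leLHS](take_size l0); apply: mx; rewrite mem_iota /=.
have XY1 : scale X * scale Y = 1 by rewrite -scale_cat -eXY.
have X_gt0 : 0 < scale X.
  rewrite lt_neqAle scale_ge0 // andbT eq_sym; apply/eqP => e.
  by move: XY1; rewrite e mul0r; lra.
(* This rotation is free, because [bdet X Y] vanishes together with V. *)
have oYX : optimal tau (Y ++ X).
  have := @optimal_swapW _ _ a b tau [::] X Y [::].
  rewrite /= !cats0 scale_nil mul1r; apply; first by rewrite -eXY.
  move: d2_0; rewrite bdetE eXY shift_cat => e.
  have -> : (1 - scale X) * shift Y - shift X * (1 - scale Y)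
    = (1 - scale X) * (scale Y * shift X + shift Y)
      + (scale X * scale Y - 1) * shift X by ring.
  by rewrite e XY1; lra.
apply: (@optimal_cut 0 1 nzd good _ _ _ _ (Y ++ X)).
- by move=> l [].
- move=> P Q [o pre]; have := pre (size P); rewrite take_size_cat // !v01.
  have : scale P * scale Q = 1 by rewrite -scale_cat (scale_opt _ o).
  have := scale_ge0 a_ge0 P; have := scale_ge0 a_ge0 Q.
  by move=> *; split; nra.
(* If [a i > 1] then [a j >= 1], so the new prefix slope is at most the slope through both
   functions, which the swap does not change. *)
- move=> P i j Q; rewrite !v01 !scale1 => hij [o pre] o'; split=> // k.
  have := pre k; have := pre (size P); have := pre (size P).+2.
  rewrite -[(size P).+2]addn2 !take_cat ltnNge leq_addr addKn /= ltnn subnn take0 cats0.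
  case: ltnP => // _; move=> h2 h0.
  move: (scale_ge0 a_ge0 P) (a_ge0 i) (a_ge0 j); case: (k - size P)%N => [|[|m]] /=.
  + by [].
  + move=> sP ai aj _; rewrite !seqE ?mulr1 in h2 h0 *.
    case: (lerP (a i) 1) => hi; first by nra.
    have {}hij : 0 <= a j - 1 by apply: hij; lra.
    by have := mulr_ge0 (mulr_ge0 sP ai) hij; nra.
  + by rewrite !seqE => _ _ _; congr (_ <= _); ring.
- move=> P i Q; rewrite v01 scale1 => hi [o pre] o'; split=> // -[|k].
    by rewrite take0 scale_nil.
  have ai : a i = 1 by lra.
  have := pre k; have := pre k.+1; rewrite /= scale_cons ai mul1r !take_cat.
  case: (ltnP k (size P)) => // kP; rewrite ltnNge (leqW kP) //= subSn //= !seqE ai mul1r.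
  by [].
- split=> // k; rewrite take_cat; case: ltnP => _; rewrite ?scale_cat.
    have := mx (size X + k)%N; rewrite eXY take_cat ltnNge leq_addr addKn /= scale_cat.
    by rewrite ger_pMr.
  rewrite -XY1 [leRHS]mulrC; apply: ler_wpM2l; first exact: scale_ge0.
  move: (k - size Y)%N => k'; have := mx k'; rewrite eXY take_cat.
  by case: ltnP => // /take_oversize ->.
Qed.

End Rotation.

(** * The partial problem *)

Section Partial.
Variables (R : realFieldType) (T : eqType) (a b : T -> R).
Hypothesis a_ge0 : forall i, 0 <= a i.

Local Notation lin := (lin a b).
Local Notation lin_seq := (lin_seq a b).
Local Notation key := (key a b).

(** The maximum builds in the choice of skipping [i], so the partial problem becomes one of ordering
    all these functions. *)
Definition step (x : R) (i : T) : R := Num.max x (lin x i).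
Definition step_seq (x : R) (l : seq T) : R := foldl step x l.

Lemma le_lin i x y : x <= y -> lin x i <= lin y i.
Proof. by move=> le; rewrite /lin lerD2r ler_wpM2l. Qed.

Lemma le_step i x y : x <= y -> step x i <= step y i.
Proof.
by move=> le; rewrite /step ge_max !le_max le (le_lin i le) orbT.
Qed.

Lemma le_step_seq l x y : x <= y -> step_seq x l <= step_seq y l.
Proof. by elim: l x y => //= i l IH x y le; apply: IH; apply: le_step. Qed.

Lemma step_seq_ge l x : x <= step_seq x l.
Proof.
elim: l x => //= i l IH x; apply: le_trans (IH _).
by rewrite /step le_max lexx.
Qed.

(** Each step is at least the function it replaces, and the remaining steps never decrease the
    value. *)
Lemma lin_seq_take_le k l x : lin_seq x (take k l) <= step_seq x l.
Proof.
rewrite -[in leRHS](cat_take_drop k l) /step_seq foldl_cat.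
apply: le_trans (step_seq_ge _ _); elim: (take k l) x => //= i s IH x.
apply: le_trans (IH _) _; apply: le_step_seq.
by rewrite /step le_max lexx orbT.
Qed.

(* When det < 0, f_i has slope < 1 and f_j either has slope > 1 and a larger fixed
   point or is a downward shift, so no x is raised by f_j and then again by f_i. *)
Lemma step_swap i j x : key i <= key j -> step (step x j) i <= step (step x i) j.
Proof.
move=> le; rewrite {1}/step ge_max; apply/andP; split.
  by apply: le_step; rewrite /step le_max lexx.
have [hj|hj] := leP x (lin x j); last first.
  have -> : step x j = x by apply/max_idPl/ltW.
  by rewrite /step !le_max lexx !orbT.
have -> : step x j = lin x j by apply/max_idPr.
have det_case : 0 <= det (1 - a i) (b i) (1 - a j) (b j) ->
    lin (lin x j) i <= step (step x i) j.
  move=> d; apply: (@le_trans _ _ (lin (lin x i) j)).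
    by move: d; rewrite /det /lin; lra.
  apply: (@le_trans _ _ (lin (step x i) j)); last by rewrite {1}/step le_max lexx orbT.
  by apply: le_lin; rewrite /step le_max lexx orbT.
case: (lerP 0 (det (1 - a i) (b i) (1 - a j) (b j))) => [/det_case //|d_lt0].
have nzi : (1 - a i != 0) || (b i != 0).
  apply: contraTT d_lt0; rewrite negb_or !negbK => /andP[/eqP-> /eqP->].
  by rewrite /det !mul0r subr0 ltxx.
have nzj : (1 - a j != 0) || (b j != 0).
  apply: contraTT d_lt0; rewrite negb_or !negbK => /andP[/eqP-> /eqP->].
  by rewrite /det !mulr0 subr0 ltxx.
have [c1 _ _ _] := det_angle nzi nzj le.
have {c1}diff : 2 < key j - key i by rewrite ltNge; apply/negP => /c1; rewrite leNgt d_lt0.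
have [i1 i2 [s s0 [ei _]]] := angleP nzi.
have [j1 j2 [t t0 [ej fj]]] := angleP nzj.
rewrite -/(key i) in i1 i2 ei; rewrite -/(key j) in j1 j2 ej fj.
(* A gap above 2 within (-1, 3] forces [key i < 1 < key j]: [f_i] has slope below 1, and [f_j] has
   slope above 1 unless [key j] is 3, the downward direction. *)
have ai : 0 < 1 - a i.
  rewrite ei mulr_gt0 // /diamond_x.
  have -> : key i < 1 by lra.
  by rewrite subr_gt0 ltr_norml; apply/andP; split; lra.
have dj : 1 - a j < 0 \/ 1 - a j = 0 /\ b j < 0.
  move: ej fj; rewrite /diamond_x /diamond_y ltNge.
  have -> /= : 1 <= key j by lra.
  case: (ltP (key j) 3) => j3 ej fj.
    left; rewrite ej pmulr_rlt0 // subr_lt0 ltr_norml; apply/andP; split; lra.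
  have e3 : key j = 3 by lra.
  right; rewrite ej fj e3.
  have -> : 3 - 2 = 1 :> R by ring.
  by rewrite normr1 subrr mulr0; split => //; lra.
have ltj : x < lin x j \/ x = lin x j.
  by move: hj; rewrite le_eqVlt => /predU1P[]; [right|left].
case: ltj => [ltj|<-]; last first.
  apply: (@le_trans _ _ (step x i)); first by rewrite /step le_max lexx orbT.
  by rewrite {1}/step le_max lexx.
apply: (@le_trans _ _ (lin x j)).
  move: d_lt0 ltj ai dj; rewrite /det /lin; set y := a j * x + b j => d_lt0 ltj ai dj.
  have {dj}aj : 1 - a j < 0 by case: dj => // -[e1 e2]; move: ltj; rewrite /y; nra.
  (* This says that [f_i] lowers [x]; having slope below 1, it then lowers the larger [y] too. *)
  have h : 0 < (1 - a j) * (b i - (1 - a i) * x).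
    by move: ltj; rewrite /y => ltj; nra.
  rewrite nmulr_rgt0 // in h.
  have : (1 - a i) * x <= (1 - a i) * y by rewrite ler_pM2l // ltW.
  by lra.
apply: le_trans (le_step j (_ : x <= step x i)).
  by rewrite /step le_max lexx orbT.
by rewrite /step le_max lexx.
Qed.

(** By [step_swap], the element of least key moves to the front past everything before it without
    loss; induction handles the rest. *)
Lemma step_seq_sorted tau l x : sorted (relpre key <=%R) tau -> perm_eq l tau ->
  step_seq x l <= step_seq x tau.
Proof.
have tr : transitive (relpre key <=%R) by move=> y z t /=; apply: le_trans.
elim: tau l x => [|i tau IH] l x srt pl; first by move/perm_nilP: pl => ->.
have il : i \in l by rewrite (perm_mem pl) mem_head.
move: pl; case/splitPr: il => P Q; rewrite -[P ++ _]/(P ++ [:: i] ++ Q) perm_catCA /=.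
rewrite perm_cons => pl.
have {}pl' : all (fun j => key i <= key j) P.
  have /allP h := order_path_min tr srt; apply/allP => j jP; apply: h.
  by rewrite -(perm_mem pl) mem_cat jP.
apply: le_trans (IH _ (step x i) (path_sorted srt) pl).
elim: P x {pl} pl' => //= j P IHP x /andP[ij allP].
apply: le_trans (IHP _ allP) _; apply: le_step_seq; exact: step_swap.
Qed.

End Partial.

(** * Timed execution of programs *)

Local Open Scope nat_scope.

Section ProgramLogic.
Variable R : realType.
Implicit Types (st : store R) (p q : cmd) (Q : store R -> Prop).

Fixpoint loop_free p : bool :=
  match p with
  | Seq p1 p2 | If _ p1 p2 => loop_free p1 && loop_free p2
  | While _ _ => false
  | _ => true
  end.

(** The effect of a loop-free program; the value on [While] is a placeholder. *)
Fixpoint run p st : store R :=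
  match p with
  | NSet x i e => Store (update (nmem st) x (neval st i) (neval st e)) (rmem st)
  | RSet x i e => Store (nmem st) (update (rmem st) x (neval st i) (reval st e))
  | Seq p1 p2 => run p2 (run p1 st)
  | If b p1 p2 => if beval st b then run p1 st else run p2 st
  | _ => st
  end.

Fixpoint wcost p : nat :=
  match p with
  | NSet _ i e => (ncost i + ncost e).+1
  | RSet _ i e => (ncost i + rcost e).+1
  | Seq p1 p2 => wcost p1 + wcost p2
  | If b p1 p2 => (bcost b + maxn (wcost p1) (wcost p2)).+1
  | _ => 1
  end.

Definition halts p st (N : nat) Q : Prop :=
  exists t st', [/\ exec p st t st', t <= N & Q st'].

Lemma exec_run p st : loop_free p ->
  exists2 t, t <= wcost p & exec p st t (run p st).
Proof.
elim: p st => //= [|x i e|x i e|p IHp q IHq|b p IHp q IHq] st.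
- by exists 1 => //; constructor.
- by eexists; last constructor.
- by eexists; last constructor.
- move=> /andP[/(IHp st)[t tle ep] /(IHq (run p st))[u ule eq]].
  by exists (t + u); [exact: leq_add | exact: exec_seq ep eq].
- move=> /andP[/(IHp st)[t tle ep] /(IHq st)[u ule eq]].
  case: ifPn => hb.
    exists (bcost b + t).+1; last exact: exec_if_true.
    by rewrite ltnS leq_add2l leq_max tle.
  exists (bcost b + u).+1; last exact: exec_if_false.
  by rewrite ltnS leq_add2l leq_max ule orbT.
Qed.

Lemma halts_run p st N Q : loop_free p -> wcost p <= N -> Q (run p st) -> halts p st N Q.
Proof.
move=> /(@exec_run p st)[t tle e] le q; exists t, (run p st).
by split=> //; exact: leq_trans le.
Qed.

Lemma halts_weaken p st N N' Q Q' : halts p st N Q -> N <= N' ->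
  (forall st', Q st' -> Q' st') -> halts p st N' Q'.
Proof.
move=> [t [st' [e le q]]] leN imp; exists t, st'.
by split; [|exact: leq_trans leN|exact: imp].
Qed.

Lemma halts_seq p q st N1 N2 Q1 Q : halts p st N1 Q1 ->
  (forall st1, Q1 st1 -> halts q st1 N2 Q) -> halts (Seq p q) st (N1 + N2) Q.
Proof.
move=> [t [st1 [e le q1]]] /(_ st1 q1) [u [st2 [e2 le2 q2]]].
by exists (t + u), st2; split; [exact: exec_seq e e2 | exact: leq_add |].
Qed.

Lemma halts_run_seq p q st N Q : loop_free p -> halts q (run p st) N Q ->
  halts (Seq p q) st (wcost p + N) Q.
Proof.
move=> lf h; apply: (@halts_seq _ _ _ _ _ (eq (run p st))) => [|_ <- //].
exact: halts_run.
Qed.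

(** The index of [I] bounds the number of iterations left; the loop may stop before it reaches 0. *)
Lemma halts_while b p N (I : nat -> store R -> Prop) h st :
  (forall k st', I k st' -> beval st' b -> 0 < k /\ halts p st' N (I k.-1)) ->
  I h st ->
  halts (While b p) st (h.+1 * (bcost b + N).+1)
    (fun st' => exists2 k, I k st' & ~~ beval st' b).
Proof.
move=> body; elim: h st => [|h IH] st Ist.
  case hb: (beval st b); first by have [] := body _ _ Ist hb.
  exists (bcost b).+1, st; split; first by apply: exec_while_false; rewrite hb.
    by lia.
  by exists 0; rewrite // hb.
case hb: (beval st b).
  have [_ [t [st1 [e1 le1 I1]]]] := body _ _ Ist hb.
  have [u [st2 [e2 le2 I2]]] := IH _ I1.
  exists (bcost b + t + u).+1, st2; split=> //; first exact: exec_while_true e1 e2.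
  by rewrite mulSn addSn ltnS; apply: leq_add => //; rewrite leq_add2l.
exists (bcost b).+1, st; split; first by apply: exec_while_false; rewrite hb.
  by rewrite mulSn addSn ltnS -addnA leq_addr.
by exists h.+1; rewrite // hb.
Qed.

Definition nvar x := NGet x (NConst 0).
Definition rvar x := RGet x (NConst 0).

Definition for_test := BNot (NLe (nvar 0) (nvar 6)).
Definition incr x := NSet x (NConst 0) (NAdd (nvar x) (NConst 1)).
Definition for_loop p :=
  Seq (NSet 6 (NConst 0) (NConst 0)) (While for_test (Seq p (incr 6))).

(** The body may itself contain loops, so its postcondition is the next invariant as seen after the
    counter in array 6 is incremented. *)
Lemma halts_for n N (I : nat -> store R -> Prop) p st :
  I 0 (run (NSet 6 (NConst 0) (NConst 0)) st) ->
  (forall k st', I k st' -> nmem st' 0 0 = n /\ nmem st' 6 0 = k) ->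
  (forall k st', k < n -> I k st' ->
     halts p st' N (fun st1 => I k.+1 (run (incr 6) st1))) ->
  halts (for_loop p) st (3 + n.+1 * (N + 13)) (I n).
Proof.
move=> I0 vars body; rewrite /for_loop.
apply: (@halts_seq _ _ _ 3 _ (I 0)); first exact: halts_run.
move=> st1 {}I0.
(* The increment costs 6; the test costs 6 and the loop rule 1, which makes the 13 of the
   statement. *)
have := @halts_while for_test (Seq p (incr 6)) (N + 6)
  (fun h st' => h <= n /\ I (n - h) st') n st1.
rewrite subnn => W; apply: (halts_weaken (W _ (conj (leqnn n) I0))).
- move=> h st' [hn Ist]; have [v0 v6] := vars _ _ Ist.
  rewrite /= v0 v6 -ltnNge => lt; have h_gt0 : 0 < h by lia.
  split=> //; apply: halts_seq (body _ _ lt Ist) _ => st2 I2.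
  apply: halts_run => //; split; first by lia.
  by have -> : n - h.-1 = (n - h).+1 by lia.
- by rewrite leq_mul2l /=; lia.
- move=> st' [h [hn Ist]]; have [v0 v6] := vars _ _ Ist.
  by rewrite /= v0 v6 negbK => le; have <- : n - h = n by lia.
Qed.

End ProgramLogic.

(** * Tournament sort *)

Section Tournament.
Variables (R : realDomainType) (K : nat -> R) (n : nat).
Implicit Types T : nat -> nat.

(* Entries of the tree are 0 (no candidate) or x.+1 for the index x. *)
Definition best x y : nat :=
  if y <= 0 then x else if x <= 0 then y
  else if (K (x - 1) <= K (y - 1))%R then x else y.

(** Heap numbering: the root is 1 and the children of [u] are [2u] and [2u + 1]. It works for every
    [n], not only powers of 2. *)
Definition node_ok T u := T u = best (T (u + u)) (T (u + u + 1)).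

Definition tree_ok T := forall u, 0 < u < n -> node_ok T u.

(* Leaf n + i is the slot of index i, and rem the set of indices still present. *)
Variables (T : nat -> nat) (rem : pred nat).
Hypothesis okT : tree_ok T.
Hypothesis leaves : forall i, i < n -> T (n + i) = if rem i then i.+1 else 0.

Lemma tree_entry v : 0 < v < n + n -> T v = 0 \/ exists i, [/\ i < n, rem i & T v = i.+1].
Proof.
have [k] := ubnP (n + n - v); elim: k v => // k IH v le_k /andP[v_gt0 v_lt].
case: (ltnP v n) => [v_n|n_v].
  rewrite okT ?v_gt0 // /best.
  have I1 : T (v + v) = 0 \/ exists i, [/\ i < n, rem i & T (v + v) = i.+1].
    by apply: IH; lia.
  have I2 : T (v + v + 1) = 0 \/ exists i, [/\ i < n, rem i & T (v + v + 1) = i.+1].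
    by apply: IH; lia.
  by case: ifP => _ //; case: ifP => _ //; case: ifP.
have := @leaves (v - n); rewrite subnKC // => ->; last by lia.
case: ifP => r; [right|by left].
by exists (v - n); split=> //; lia.
Qed.

(** Climbing from leaf [n + i] by halving the node number, the key of the entry never increases. *)
Lemma tree_root i : i < n -> rem i ->
  exists x, [/\ x < n, rem x, T 1 = x.+1 & (K x <= K i)%R].
Proof.
move=> i_n ri; have n_gt0 : 0 < n by exact: leq_ltn_trans i_n.
suff [x [Tx le]] : exists x, T 1 = x.+1 /\ (K x <= K i)%R.
  have [|e|[y [y_n ry e]]] := @tree_entry 1; first by lia.
    by rewrite e in Tx.
  by exists y; split=> //; move: e; rewrite Tx => -[<-].
suff up v : 0 < v < n + n -> (exists x, T v = x.+1 /\ (K x <= K i)%R) ->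
    exists x, T 1 = x.+1 /\ (K x <= K i)%R.
  apply: (up (n + i)); first by lia.
  by exists i; rewrite leaves // ri.
have [k] := ubnP v; elim: k v => // k IH v le_k /andP[v_gt0 v_lt] [x [Tv le]].
case: (leqP v 1) => [v1|v_gt1].
  by have <- : v = 1 by [lia]; exists x.
have h_gt0 : 0 < v./2 by lia.
have h_lt : v./2 < n by lia.
apply: (IH v./2); [lia|lia|].
rewrite okT ?h_gt0 // /best.
case ov: (odd v).
  have -> : v./2 + v./2 + 1 = v by lia.
  rewrite Tv /= subn1 /=.
  case: leqP => [_|]; first by exists x.
  case: (T (v./2 + v./2)) => // y _; rewrite subn1 /=.
  case: ifP => hxy; last by exists x.
  by exists y; split=> //; exact: Order.POrderTheory.le_trans le.
have -> : v./2 + v./2 = v by lia.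
case: leqP => [_|]; first by exists x.
case: (T (v + 1)) => // y _; rewrite Tv /= !subn1 /=.
case: ifP => hxy; first by exists x.
exists y; split=> //; apply: Order.POrderTheory.le_trans le.
by apply: Order.POrderTheory.ltW; rewrite Order.TotalTheory.ltNge hxy.
Qed.

End Tournament.

(** * The sorting program: keys, tree updates, insertion and extraction *)

Section Sorting.
Variable R : realType.
Implicit Types st : store R.

Definition zero := NConst 0.
Definition one := NConst 1.
Definition iset x e := NSet x zero e.
Definition fset x e := RSet x zero e.

(* Integer arrays: 0 size, 1 output permutation, 2 output k, 3 parents and
   4 entries of the tournament tree, 5 sorted indices, 6 loop counter, 7 to 10
   scratch. Real arrays: 0 slopes, 1 intercepts, 2 constant c, 3 keys, 4 and 5
   slopes and intercepts of the suffix compositions, 6 to 9 scratch. *)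

Definition rtwo := RAdd ROne ROne.

Definition set_abs x y := If (RLe RZero (rvar y)) (fset x (rvar y)) (fset x (RSub RZero (rvar y))).

Definition set_key :=
  Seq (fset 6 (RSub ROne (RGet 0 (nvar 6)))) (
  Seq (fset 7 (RGet 1 (nvar 6))) (
  Seq (set_abs 8 6) (
  Seq (set_abs 9 7) (
  Seq (fset 8 (RAdd (rvar 8) (rvar 9)))
  (If (RLe (rvar 8) RZero) (RSet 3 (nvar 6) (RAdd rtwo rtwo))
  (If (RLe (rvar 6) RZero) (RSet 3 (nvar 6) (RSub rtwo (RDiv (rvar 7) (rvar 8))))
     (RSet 3 (nvar 6) (RDiv (rvar 7) (rvar 8))))))))).

Lemma run_seq p q st : run (Seq p q) st = run q (run p st).
Proof. by []. Qed.

Lemma run_set_abs x y st : let st' := run (set_abs x y) st in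
  nmem st' = nmem st /\ rmem st' = update (rmem st) x 0 `|rmem st y 0|%R.
Proof.
rewrite /set_abs /=; case: ifPn => h; split=> //=; congr update.
  by rewrite Num.Theory.ger0_norm.
rewrite -Order.TotalTheory.ltNge in h.
by rewrite Num.Theory.ltr0_norm // GRing.sub0r.
Qed.

Lemma run_set_key st : let st' := run set_key st in let i := nmem st 6 0 in
  [/\ nmem st' = nmem st,
      rmem st' 3 i = angle (1 - rmem st 0 i)%R (rmem st 1 i),
      forall j, j != i -> rmem st' 3 j = rmem st 3 j &
      forall y j, y < 3 -> rmem st' y j = rmem st y j].
Proof.
rewrite /set_key !run_seq.
set st2 := run (fset 7 _) _.
have [n3 r3] := run_set_abs 8 6 st2.
have [n4 r4] := run_set_abs 9 7 (run (set_abs 8 6) st2).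
move: (run (set_abs 9 7) _) n4 r4 => st4; rewrite {}n3 {}r3 => n4 r4.
set i := nmem st 6 0.
have e6 : rmem st4 6 0 = (1 - rmem st 0 i)%R by rewrite r4.
have e7 : rmem st4 7 0 = rmem st 1 i by rewrite r4.
have e8 : rmem st4 8 0 = `|1 - rmem st 0 i|%R by rewrite r4.
have e9 : rmem st4 9 0 = `|rmem st 1 i|%R by rewrite r4.
have er y j : y < 6 -> rmem st4 y j = rmem st y j.
  move=> y6; have ne k : 6 <= k -> (y == k) = false by lia.
  by rewrite r4 /update !ne // /st2 /= /update !ne.
have ni : nmem st4 6 0 = i by rewrite n4.
set st5 := run (fset 8 _) st4.
have n5 : nmem st5 = nmem st by [].
have f6 : rmem st5 6 0 = (1 - rmem st 0 i)%R by rewrite /st5 /= /update.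
have f7 : rmem st5 7 0 = rmem st 1 i by rewrite /st5 /= /update.
have f8 : rmem st5 8 0 = (`|1 - rmem st 0 i| + `|rmem st 1 i|)%R.
  by rewrite /st5 /= /update /= e8 e9.
have fr y j : y < 6 -> rmem st5 y j = rmem st y j.
  move=> y6; have ne : (y == 8) = false by lia.
  by rewrite /st5 /= /update ne /= er.
move: st5 n5 f6 f7 f8 fr => st5 n5 f6 f7 f8 fr.
have n6 : nmem st5 6 0 = i by rewrite n5.
suff [v [ev ->]] : exists v, v = angle (1 - rmem st 0 i)%R (rmem st 1 i) /\
    run (If (RLe (rvar 8) RZero) (RSet 3 (nvar 6) (RAdd rtwo rtwo))
      (If (RLe (rvar 6) RZero) (RSet 3 (nvar 6) (RSub rtwo (RDiv (rvar 7) (rvar 8))))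
         (RSet 3 (nvar 6) (RDiv (rvar 7) (rvar 8))))) st5
    = Store (nmem st5) (update (rmem st5) 3 i v).
  split=> //=; first by rewrite /update !eqxx.
    by move=> j /negPf ne; rewrite /update ne andbF fr.
  move=> y j y3; rewrite /update (ltn_eqF y3) /= fr //; lia.
eexists; split; first by [].
rewrite /angle [run _ _]/= f6 f7 f8 n6.
case: ifPn => // _; first by congr (Store _ (update _ _ _ _)); ring.
by case: ifPn => // _; congr (Store _ (update _ _ _ _)); ring.
Qed.
End Sorting.

(** A node condition reads only the node and its two children, so changing entry [v] can affect only
    [v] and its parent. *)
Lemma node_ok_off (R : realDomainType) (K : nat -> R) T T' v u :
  (forall j, j != v -> T' j = T j) -> 0 < u -> u != v -> u != v./2 ->
  node_ok K T u -> node_ok K T' u.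
Proof.
move=> off u_gt0 uv uv2; rewrite /node_ok !off //; first by lia.
by lia.
Qed.

Section SortSteps.
Variable R : realType.
Implicit Types st : store R.
Variables (n : nat) (A B : nat -> R) (c : R).

Definition input st :=
  [/\ nmem st 0 0 = n, rmem st 0 =1 A, rmem st 1 =1 B & rmem st 2 0 = c].

(** The machine cannot halve an integer, so the parents are tabulated. *)
Definition set_parents :=
  Seq (NSet 3 (NAdd (nvar 6) (nvar 6)) (nvar 6))
      (NSet 3 (NAdd (NAdd (nvar 6) (nvar 6)) one) (nvar 6)).

Definition setup := Seq set_key set_parents.

Definition setup_inv k st :=
  [/\ input st, nmem st 6 0 = k, forall i, i < k -> rmem st 3 i = key A B i,
      forall v, v < k + k -> nmem st 3 v = v./2 & forall v, nmem st 4 v = 0].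

Lemma halts_setup st : input st -> (forall v, nmem st 4 v = 0) ->
  halts (for_loop setup) st (3 + n.+1 * (wcost setup + 13)) (setup_inv n).
Proof.
move=> [i0 iA iB ic] t0; apply: halts_for.
- by split.
- by move=> k st' [[]].
move=> k st1 _ [[n1 A1 B1 c1] l1 K1 P1 T1]; apply: halts_run => //.
rewrite /setup run_seq; have [kn k3 kj kr] := run_set_key st1.
move: (run set_key st1) kn k3 kj kr => st2 kn k3 kj kr.
rewrite l1 in k3 kj; split=> /=.
- rewrite /input /update /= kn n1.
  by split=> // [j|j|]; rewrite kr // ?A1 ?B1.
- by rewrite /update /= kn l1 addn1.
- move=> i; rewrite ltnS leq_eqVlt => /predU1P[->|ik]; first by rewrite k3 A1 B1.
  by rewrite kj ?K1 // ltn_eqF.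
- move=> v; rewrite /update /= kn l1 => vk.
  case: eqP => [->|]; first by lia.
  case: eqP => [->|]; first by lia.
  by move=> *; apply: P1; lia.
- by move=> v; rewrite /update /= kn T1.
Qed.

Definition sift_body :=
  Seq (iset 7 (NGet 3 (nvar 7))) (
  Seq (iset 8 (NGet 4 (NAdd (nvar 7) (nvar 7)))) (
  Seq (iset 9 (NGet 4 (NAdd (NAdd (nvar 7) (nvar 7)) one)))
  (If (NLe (nvar 9) zero) (NSet 4 (nvar 7) (nvar 8))
  (If (NLe (nvar 8) zero) (NSet 4 (nvar 7) (nvar 9))
  (If (RLe (RGet 3 (NSub (nvar 8) one)) (RGet 3 (NSub (nvar 9) one)))
     (NSet 4 (nvar 7) (nvar 8)) (NSet 4 (nvar 7) (nvar 9))))))).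

Definition sift := While (BNot (NLe (nvar 7) one)) sift_body.

Definition sift_cost h := h.+1 * (5 + wcost sift_body).+1.

Definition tree_vars := [:: 4; 7; 8; 9].

Lemma run_sift_body st : let st' := run sift_body st in
  let p := nmem st 3 (nmem st 7 0) in let T := nmem st 4 in
  [/\ rmem st' = rmem st, nmem st' 7 0 = p,
      forall y j, y \notin tree_vars -> nmem st' y j = nmem st y j,
      nmem st' 4 p = best (rmem st 3) (T (p + p)) (T (p + p + 1)) &
      forall j, j != p -> nmem st' 4 j = T j].
Proof.
rewrite /best /tree_vars /sift_body !run_seq.
set st3 := run _ (run _ (run _ st)).
have r3 : rmem st3 = rmem st by [].
have v3 : nmem st3 7 0 = nmem st 3 (nmem st 7 0) by [].
move: (nmem st 3 _) v3 => p v3.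
have x3 : nmem st3 8 0 = nmem st 4 (p + p) by rewrite -v3.
have y3 : nmem st3 9 0 = nmem st 4 (p + p + 1) by rewrite -v3.
have o3 y j : y \notin [:: 7; 8; 9] -> nmem st3 y j = nmem st y j.
  rewrite !inE !negb_or => /and3P[/negPf a /negPf b /negPf d].
  by rewrite /= /update a b d.
move: st3 r3 v3 x3 y3 o3 => st3 r3 v3 x3 y3 o3.
set cond := If _ _ _.
have [v -> ev] : exists2 v, run cond st3
      = Store (update (nmem st3) 4 p v) (rmem st) &
    v = if nmem st 4 (p + p + 1) <= 0 then nmem st 4 (p + p)
        else if nmem st 4 (p + p) <= 0 then nmem st 4 (p + p + 1)
        else if (rmem st 3 (nmem st 4 (p + p) - 1) <= rmem st 3 (nmem st 4 (p + p + 1) - 1))%R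
        then nmem st 4 (p + p) else nmem st 4 (p + p + 1).
  eexists; last by [].
  rewrite /= v3 x3 y3 r3.
  by case: ifP => _ //; case: ifP => _ //; case: ifP.
rewrite -ev /= /update /= eqxx.
split=> // [y j|j /negPf ne].
  rewrite !inE !negb_or => /and4P[/negPf a b d e]; rewrite a o3 //.
  by rewrite !inE !negb_or b d.
by rewrite ne o3.
Qed.

Definition sifted st st' :=
  [/\ rmem st' = rmem st,
      forall y j, y \notin tree_vars -> nmem st' y j = nmem st y j,
      tree_ok (rmem st 3) n (nmem st' 4) &
      forall u, n <= u -> nmem st' 4 u = nmem st 4 u].

(** Only the parent of the current node may be wrong; recomputing it moves the possible defect one
    level up, and the power of 2 bounds the number of levels. *)
Lemma halts_sift h st : 0 < nmem st 7 0 < n + n -> nmem st 7 0 < 2 ^ h.+1 ->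
  (forall u, u < n + n -> nmem st 3 u = u./2) ->
  (forall u, 0 < u < n -> u != (nmem st 7 0)./2 -> node_ok (rmem st 3) (nmem st 4) u) ->
  halts sift st (sift_cost h) (sifted st).
Proof.
move=> v_bd v_h par ok.
pose I k st' := [/\ 0 < nmem st' 7 0 < n + n, nmem st' 7 0 < 2 ^ k.+1,
  rmem st' = rmem st /\ forall y j, y \notin tree_vars -> nmem st' y j = nmem st y j,
  forall u, 0 < u < n -> u != (nmem st' 7 0)./2 -> node_ok (rmem st 3) (nmem st' 4) u &
  forall u, n <= u -> nmem st' 4 u = nmem st 4 u].
have W := @halts_while R (BNot (NLe (nvar 7) one)) sift_body (wcost sift_body) I h st.
apply: halts_weaken (W _ _) _ _; last 1 first.
- move=> st' [k [bd _ [fr fn] ok' lv]]; rewrite /= negbK => v1.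
  split=> // u /andP[u_gt0 u_n]; apply: ok'; first by rewrite u_gt0.
  by lia.
- move=> k st1 [bd bk [fr fn] ok1 lv]; rewrite /= -ltnNge => v_gt1.
  have k_gt0 : 0 < k.
    by case: k bk => // ; rewrite expn1; lia.
  split=> //; apply: halts_run => //.
  have [r2 v2 o2 p2 j2] := run_sift_body st1.
  have e3 : nmem st1 3 (nmem st1 7 0) = (nmem st1 7 0)./2.
    by rewrite fn // par //; case/andP: bd.
  rewrite e3 in v2 p2 j2.
  move: (run sift_body st1) r2 v2 o2 p2 j2 => st2 r2 v2 o2 p2 j2.
  set p := (nmem st1 7 0)./2 in v2 p2 j2.
  have p_gt0 : 0 < p by rewrite /p; lia.
  have p_n : p < n by rewrite /p; lia.
  split; rewrite ?v2.
  + by lia.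
  + rewrite prednK //; move: bk; rewrite expnS /p; lia.
  + by split; [rewrite r2 | move=> y j hy; rewrite o2 // fn].
  + move=> u /andP[u_gt0 u_n] up; case: (eqVneq u p) => [->|ne].
      by rewrite /node_ok p2 !j2 ?fr //; lia.
    apply: node_ok_off (j2) _ _ _ _ => //.
    by apply: ok1 => //; rewrite u_gt0.
  + by move=> u un; rewrite j2 ?lv //; lia.
- by [].
- by [].
Qed.

End SortSteps.

Section SortLoops.
Variable R : realType.
Implicit Types st : store R.
Variables (n : nat) (A B : nat -> R) (c : R).

Local Notation input := (input n A B c).

Definition insert :=
  Seq (NSet 4 (NAdd (nvar 0) (nvar 6)) (NAdd (nvar 6) one)) (
  Seq (iset 7 (NAdd (nvar 0) (nvar 6))) sift).

Definition extract :=
  Seq (iset 10 (NSub (NGet 4 one) one)) (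
  Seq (NSet 5 (nvar 6) (nvar 10)) (
  Seq (iset 7 (NAdd (nvar 0) (nvar 10))) (
  Seq (NSet 4 (nvar 7) zero) sift))).

Definition loop_inv (K : nat -> R) k st :=
  [/\ input st, nmem st 6 0 = k, rmem st 3 = K,
      forall v, v < n + n -> nmem st 3 v = v./2 & tree_ok K n (nmem st 4)].

Definition insert_inv K k st := loop_inv K k st /\
  forall i, i < n -> nmem st 4 (n + i) = if i < k then i.+1 else 0.

Lemma loop_inv_incr K k st : loop_inv K k st -> loop_inv K k.+1 (run (incr 6) st).
Proof.
move=> [i e r p t]; split=> //.
by rewrite /= /update /= e addn1.
Qed.

Lemma loop_inv_sifted K k st0 st st' : loop_inv K k st0 -> rmem st = rmem st0 ->
  (forall y, y \in [:: 0; 3; 6] -> nmem st y = nmem st0 y) ->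
  sifted n st st' -> loop_inv K k st'.
Proof.
move=> [[i0 iA iB ic] e r p t] rs ns [r' n' t' _].
have f y j : y \in [:: 0; 3; 6] -> nmem st' y j = nmem st0 y j.
  by move=> hy; rewrite n' ?ns //; move: hy; rewrite !inE => /or3P[] /eqP->.
split.
- by split=> [|i|i|]; rewrite ?f // r' rs.
- by rewrite f.
- by rewrite r' rs.
- by move=> v vn; rewrite f // p.
- by move: t'; rewrite rs r.
Qed.

Definition height := trunc_log 2 n + 1.

Lemma height_bound v : v < n + n -> v < 2 ^ height.+1.
Proof.
move=> vn; have n_lt : n < 2 ^ (trunc_log 2 n).+1 by exact: trunc_log_ltn.
rewrite /height addn1 expnS mul2n -addnn; apply: leq_trans vn _.
by apply: leq_add; exact: ltnW.
Qed.

Lemma halts_insert K st : loop_inv K 0 (run (iset 6 zero) st) ->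
  (forall v, nmem st 4 v = 0) ->
  halts (for_loop insert) st (3 + n.+1 * (wcost insert + sift_cost height + 13))
    (insert_inv K n).
Proof.
move=> I0 t0; apply: halts_for.
- by split=> // i _; rewrite ltn0 /= /update /= t0.
- by move=> k st' [[[]]].
move=> k st1 k_n [L lv]; have [[i0 _ _ _] e6 r3 par ok] := L.
apply: (@halts_weaken _ _ _ (_ + (_ + sift_cost height)) _ (sifted n
  (run (iset 7 (NAdd (nvar 0) (nvar 6)))
  (run (NSet 4 (NAdd (nvar 0) (nvar 6)) (NAdd (nvar 6) one)) st1)))).
- do 2!apply: halts_run_seq => //.
  set st2 := run _ (run _ st1).
  have e7 : nmem st2 7 0 = n + k by rewrite /= /update /= i0 e6.
  have e4 j : nmem st2 4 j = if j == n + k then k.+1 else nmem st1 4 j.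
    by rewrite /= /update /= i0 e6 addn1.
  apply: halts_sift; rewrite ?e7.
  + by apply/andP; split; lia.
  + by apply: height_bound; lia.
  + exact: par.
  + move=> u /andP[u_gt0 u_n] ne; apply: (@node_ok_off _ _ (nmem st1 4) _ (n + k)) => //.
    * by move=> j /negPf ne'; rewrite e4 ne'.
    * by lia.
    * by rewrite r3; apply: ok; rewrite u_gt0.
- by [].
- move=> st2 sf; split.
    apply: loop_inv_incr; apply: loop_inv_sifted L _ _ sf => //.
    by move=> y; rewrite !inE => /or3P[] /eqP->.
  move=> i i_n; have [_ _ _ lv2] := sf.
  rewrite [LHS]lv2 ?leq_addr // /= /update /= i0 e6 eqn_add2l addn1 ltnS leq_eqVlt.
  by case: eqP => [->//|_] /=; exact: lv.
Qed.

(** [s] lists the extracted indices. Since no remaining key is smaller than theirs, appending the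
    next minimum keeps [s] sorted. *)
Definition extract_inv K k st := loop_inv K k st /\
  exists s : seq nat, [/\ [/\ size s = k, uniq s & all (gtn n) s],
    forall p, p < k -> nmem st 5 p = nth 0 s p,
    pairwise (relpre K <=%R) s,
    forall x i, x \in s -> i < n -> i \notin s -> (K x <= K i)%R &
    forall i, i < n -> nmem st 4 (n + i) = if i \notin s then i.+1 else 0].

Lemma halts_extract K st : insert_inv K n st ->
  halts (for_loop extract) st (3 + n.+1 * (wcost extract + sift_cost height + 13))
    (extract_inv K n).
Proof.
move=> [[i0 e0 r0 p0 t0] lv0]; apply: halts_for.
- split=> //; exists [::]; split=> // i i_n.
  by rewrite /= /update /= lv0 ?i_n.
- by move=> k st' [[[]]].
move=> k st1 k_n [L [s [[sz us all_s] s5 sort_s min_s lv]]].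
have [[i1 _ _ _] e6 r3 par ok] := L.
(* Pigeonhole: fewer than [n] indices are extracted, so the root is not empty. *)
have [i [i_n i_s]] : exists i, i < n /\ i \notin s.
  case: (boolP (all [in s] (iota 0 n))) => [/allP sub|/allPn[i]].
    have := uniq_leq_size (iota_uniq 0 n) sub.
    by rewrite size_iota sz leqNgt k_n.
  by rewrite mem_iota => /andP[_ i_n] i_s; exists i.
have [x [x_n x_s T1 _]] := tree_root ok lv i_n i_s.
have x_min j : j < n -> j \notin s -> (K x <= K j)%R.
  move=> j_n j_s; have [y [_ _ + le]] := tree_root ok lv j_n j_s.
  by rewrite T1 => -[->].
apply: (@halts_weaken _ _ _ (_ + (_ + (_ + (_ + sift_cost height)))) _ (sifted n
  (run (NSet 4 (nvar 7) zero) (run (iset 7 (NAdd (nvar 0) (nvar 10)))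
  (run (NSet 5 (nvar 6) (nvar 10)) (run (iset 10 (NSub (NGet 4 one) one)) st1)))))).
- do 4!apply: halts_run_seq => //.
  set st2 := run _ (run _ (run _ (run _ st1))).
  have e7 : nmem st2 7 0 = n + x by rewrite /= /update /= i1 T1 subn1.
  have e4 j : nmem st2 4 j = if j == n + x then 0 else nmem st1 4 j.
    by rewrite /= /update /= i1 T1 subn1.
  apply: halts_sift; rewrite ?e7.
  + by apply/andP; split; lia.
  + by apply: height_bound; lia.
  + exact: par.
  + move=> u /andP[u_gt0 u_n] ne; apply: (@node_ok_off _ _ (nmem st1 4) _ (n + x)) => //.
    * by move=> j /negPf ne'; rewrite e4 ne'.
    * by lia.
    * by rewrite r3; apply: ok; rewrite u_gt0.
- by [].
- move=> st2 sf; split.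
    apply: loop_inv_incr; apply: loop_inv_sifted L _ _ sf => //.
    by move=> y; rewrite !inE => /or3P[] /eqP->.
  have [_ n2 _ lv2] := sf; exists (rcons s x); split.
  + by rewrite size_rcons sz rcons_uniq x_s us all_rcons /= x_n.
  + move=> p; rewrite ltnS => p_k; rewrite [LHS]n2 // nth_rcons sz /= /update /= e6 T1 subn1.
    move: p_k; rewrite leq_eqVlt => /predU1P[->|p_k].
      by rewrite !eqxx ltnn.
    by rewrite (ltn_eqF p_k) p_k s5.
  + rewrite pairwise_rcons sort_s andbT; apply/allP => y ys /=.
    exact: min_s.
  + move=> y j; rewrite !mem_rcons !inE negb_or => /predU1P[->|ys] j_n /andP[_ j_s].
      exact: x_min.
    exact: min_s.
  + move=> j j_n; rewrite [LHS]lv2 ?leq_addr // /= /update /= i1 T1 subn1 eqn_add2l.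
    by rewrite mem_rcons inE negb_or; case: eqP => [//|_] /=; rewrite lv.
Qed.

Definition sort_program :=
  Seq (for_loop setup) (Seq (for_loop insert) (for_loop extract)).

Definition sort_cost :=
  3 + n.+1 * (wcost setup + 13) +
  (3 + n.+1 * (wcost insert + sift_cost height + 13) +
  (3 + n.+1 * (wcost extract + sift_cost height + 13))).

Definition sorted_store (s : seq nat) st := [/\ input st, perm_eq s (iota 0 n),
  sorted (relpre (key A B) <=%R) s & forall p, p < n -> nmem st 5 p = nth 0 s p].

Lemma halts_sort st : input st -> (forall v, nmem st 4 v = 0) ->
  halts sort_program st sort_cost (fun st' => exists s, sorted_store s st').
Proof.
move=> ist t0; apply: halts_seq (halts_setup ist t0) _ => st1 [i1 l1 k1 p1 t1].
pose K := rmem st1 3.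
apply: (@halts_seq _ _ _ _ _ _ (insert_inv K n)).
  apply: (halts_insert _ t1); split=> //.
  by move=> u _; rewrite /node_ok /= /update /= !t1.
move=> st2 /halts_extract h; apply: halts_weaken h _ _ => // st3.
move=> [[i3 _ _ _ _] [s [[sz us all_s] s5 sort_s _ _]]]; exists s.
have sub x : x \in s -> x < n by move/(allP all_s).
split=> //.
  apply: uniq_perm => //; first exact: iota_uniq.
  have subI : {subset s <= iota 0 n} by move=> x /sub x_n; rewrite mem_iota.
  by have [|_ //] := uniq_min_size us subI; rewrite size_iota sz.
rewrite (@eq_in_sorted _ (gtn n) _ (relpre K <=%R)) //; first exact: pairwise_sorted.
by move=> x y xn yn /=; rewrite /K !k1.
Qed.

End SortLoops.

(** * Choosing the best rotation *)

Section Selection.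
Variable R : realType.
Implicit Types st : store R.
Variables (n : nat) (A B : nat -> R) (c : R) (s : seq nat).

Local Notation sorted_store := (sorted_store n A B c s).
Local Notation value := (lin_seq A B c).

Lemma sorted_store_frame st st' : sorted_store st ->
  nmem st' 0 0 = nmem st 0 0 -> nmem st' 5 = nmem st 5 ->
  (forall y, y < 3 -> rmem st' y = rmem st y) -> sorted_store st'.
Proof.
move=> [[i0 iA iB ic] ps ss s5] e0 e5 e; split=> //.
  by split; [rewrite e0 | move=> i; rewrite e | move=> i; rewrite e | rewrite e].
by move=> p pn; rewrite e5 s5.
Qed.

Lemma sorted_store_size st : sorted_store st -> size s = n.
Proof. by case=> _ /perm_size; rewrite size_iota. Qed.

Definition suffix_body :=
  Seq (iset 7 (NSub (NSub (nvar 0) one) (nvar 6))) (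
  Seq (iset 8 (NGet 5 (nvar 7))) (
  Seq (RSet 4 (nvar 7) (RMul (RGet 0 (nvar 8)) (RGet 4 (NAdd (nvar 7) one))))
      (RSet 5 (nvar 7) (RAdd (RMul (RGet 4 (NAdd (nvar 7) one)) (RGet 1 (nvar 8)))
                             (RGet 5 (NAdd (nvar 7) one)))))).

Definition suffix_values st m :=
  rmem st 4 m = scale A (drop m s) /\ rmem st 5 m = shift A B (drop m s).

Definition suffix_inv k st := [/\ sorted_store st, nmem st 6 0 = k &
  forall m, n - k <= m <= n -> suffix_values st m].

Lemma halts_suffix st : sorted_store st -> suffix_values st n ->
  halts (for_loop suffix_body) st (3 + n.+1 * (wcost suffix_body + 13)) (suffix_inv n).
Proof.
move=> ss sv; apply: halts_for.
- split=> //.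
  by move=> m m_n; have -> : m = n by lia.
- by move=> k st' [[[]]].
move=> k st1 k_n [ss1 l1 sv1]; apply: halts_run => //.
have sz := sorted_store_size ss1.
have [[n1 A1 B1 c1] _ _ s5] := ss1.
set v := n - k.+1; have v_n : v < n by rewrite /v; lia.
have vE : n - 1 - k = v by rewrite /v; lia.
have [Q4 Q5] : suffix_values st1 v.+1 by apply: sv1; rewrite /v; lia.
split.
- by apply: (sorted_store_frame ss1) => // -[|[|[|]]].
- by rewrite /= /update /= l1 addn1.
move=> m m_n; case: (eqVneq m v) => [->|ne]; last first.
  have [q4 q5] : suffix_values st1 m by apply: sv1; move: ne; rewrite /v; lia.
  by rewrite /suffix_values /= /update /= n1 l1 vE (negPf ne).
rewrite /suffix_values (drop_nth 0) ?sz // scale_cons shift_cons.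
rewrite /= /update /= n1 l1 vE eqxx addn1 (gtn_eqF (ltnSn v)) /=.
by rewrite s5 // Q4 Q5 A1 B1.
Qed.

Definition scan_body :=
  Seq (fset 9 (RAdd (RMul (rvar 6) (RAdd (RMul (RGet 4 (nvar 6)) (rvar 2)) (RGet 5 (nvar 6))))
                    (rvar 7))) (
  Seq (If (RLe (rvar 8) (rvar 9)) (Seq (fset 8 (rvar 9)) (iset 10 (nvar 6))) Skip) (
  Seq (iset 8 (NGet 5 (nvar 6))) (
  Seq (fset 7 (RAdd (RMul (RGet 0 (nvar 8)) (rvar 7)) (RGet 1 (nvar 8))))
      (fset 6 (RMul (RGet 0 (nvar 8)) (rvar 6)))))).

(** The separate bound on [value s] covers the rotations by [j >= n], which leave [s] unchanged. *)
Definition scan_inv k st := [/\ sorted_store st, nmem st 6 0 = k,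
  forall m, m <= n -> suffix_values st m,
  rmem st 6 0 = scale A (take k s) /\ rmem st 7 0 = shift A B (take k s) &
  [/\ nmem st 10 0 <= n, rmem st 8 0 = value (rot (nmem st 10 0) s),
    (value s <= rmem st 8 0)%R &
    forall j, j < k -> (value (rot j s) <= rmem st 8 0)%R]].

(** The rotation applies the suffix before the prefix, so each value takes constant time from the
    suffix tables and the running prefix. *)
Lemma value_rot j : value (rot j s) =
  (scale A (take j s) * (scale A (drop j s) * c + shift A B (drop j s))
   + shift A B (take j s))%R.
Proof. by rewrite /rot /lin_seq foldl_cat -!/(lin_seq _ _ _ _) !lin_seqE. Qed.

Lemma halts_scan st : sorted_store st -> (forall m, m <= n -> suffix_values st m) ->
  rmem st 6 0 = 1%R -> rmem st 7 0 = 0%R -> nmem st 10 0 = 0 ->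
  rmem st 8 0 = value s ->
  halts (for_loop scan_body) st (3 + n.+1 * (wcost scan_body + 13)) (scan_inv n).
Proof.
move=> ss sv e6 e7 e10 e8; apply: halts_for.
- split=> //.
    by rewrite take0 scale_nil shift_nil.
  by rewrite /= /update /= e10 rot0 e8; split.
- by move=> k st' [[[]]].
move=> k st1 k_n [ss1 l1 sv1 [p6 p7] [m_n m8 m0 mj]]; apply: halts_run => //.
have sz := sorted_store_size ss1.
have [[n1 A1 B1 c1] _ _ s5] := ss1.
have [Q4 Q5] := sv1 _ (ltnW k_n).
rewrite /scan_body !run_seq; set st2 := run (fset 9 _) st1.
have e9 : rmem st2 9 0 = value (rot k s).
  by rewrite value_rot /= /update /= p6 p7 l1 Q4 Q5 c1.
set st3 := run (If _ _ _) st2.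
have [r3 n3 t3] : [/\ (forall y, y != 8 -> y != 9 -> rmem st3 y = rmem st1 y),
    (forall y, y != 10 -> nmem st3 y = nmem st1 y)
  & [/\ nmem st3 10 0 <= n, rmem st3 8 0 = value (rot (nmem st3 10 0) s),
    (value s <= rmem st3 8 0)%R &
    forall j, j < k.+1 -> (value (rot j s) <= rmem st3 8 0)%R]].
  have r2 y : y != 9 -> rmem st2 y = rmem st1 y.
    by move=> /negPf y9; rewrite /= /update y9.
  have n2 : nmem st2 = nmem st1 by [].
  have f8 : rmem st2 8 0 = rmem st1 8 0 by rewrite r2.
  move: st2 e9 r2 n2 f8 @st3 => st2 e9' r2 n2 e8' /=.
  rewrite e8' e9'; case: ifPn => le.
    split=> [y /negPf y8 y9|y /negPf y10|] /=; rewrite ?n2.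
    - by rewrite /update y8 -r2.
    - by rewrite /update y10.
    rewrite /update /= l1; split=> //; first exact: ltnW.
      exact: Order.POrderTheory.le_trans le.
    move=> j; rewrite ltnS leq_eqVlt => /predU1P[->//|/mj].
    by move/Order.POrderTheory.le_trans; apply.
  split=> [y _ y9|y _|]; rewrite ?n2 ?r2 //; split=> //.
  move=> j; rewrite ltnS leq_eqVlt => /predU1P[->|/mj //].
  by apply: Order.POrderTheory.ltW; rewrite Order.TotalTheory.ltNge.
move: st3 r3 n3 t3 => st3 r3 n3 [t1 t2 t3 t4].
have x_k : nmem st3 5 (nmem st3 6 0) = nth 0 s k by rewrite !n3 // l1 s5.
have take_k : take k.+1 s = take k s ++ [:: nth 0 s k].
  by rewrite (take_nth 0) ?sz // cats1.
split=> //=.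
- apply: (sorted_store_frame ss1).
  + by rewrite /update /= n3.
  + exact: n3.
  + by move=> [|[|[|]]] // _; exact: r3.
- by rewrite /update /= n3 // l1 addn1.
- by move=> m /sv1; rewrite /suffix_values /= /update /= !r3.
- rewrite take_k scale_cat shift_cat scale1 shift1 /update /= x_k.
  by rewrite !r3 // A1 B1 p6 p7; split=> //; ring.
Qed.

(** One conditional subtraction reduces the position modulo [n], as counter plus offset stays below
    [2n]. *)
Definition output_body :=
  Seq (iset 7 (NAdd (nvar 6) (nvar 10)))
  (If (NLe (nvar 0) (nvar 7)) (NSet 1 (nvar 6) (NGet 5 (NSub (nvar 7) (nvar 0))))
     (NSet 1 (nvar 6) (NGet 5 (nvar 7)))).

Definition output_inv m k st := [/\ sorted_store st, nmem st 6 0 = k, nmem st 10 0 = m &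
  forall p, p < k -> nmem st 1 p = nth 0 (rot m s) p].

Lemma halts_output m st : sorted_store st -> nmem st 10 0 = m -> m <= n ->
  halts (for_loop output_body) st (3 + n.+1 * (wcost output_body + 13)) (output_inv m n).
Proof.
move=> ss em m_n; apply: halts_for.
- by split.
- by move=> k st' [[[]]].
move=> k st1 k_n [ss1 l1 m1 o1]; apply: halts_run => //.
have sz := sorted_store_size ss1.
have [[n1 A1 B1 c1] _ _ s5] := ss1.
have -> : run output_body st1 = Store
    (update (update (nmem st1) 7 0 (k + m)) 1 k (nth 0 (rot m s) k)) (rmem st1).
  rewrite /output_body run_seq; set st2 := run _ st1.
  have n2 : nmem st2 = update (nmem st1) 7 0 (k + m) by rewrite /= l1 m1.
  have r2 : rmem st2 = rmem st1 by [].
  move: st2 n2 r2 => st2 n2 r2.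
  rewrite /= n2 r2 /update /= n1 l1 /rot nth_cat size_drop sz nth_drop.
  case: (leqP n (k + m)) => km.
    have -> : (k < n - m) = false by lia.
    rewrite nth_take; last by lia.
    by have -> : k - (n - m) = k + m - n by [lia]; rewrite /= s5 //; lia.
  have -> : (k < n - m) = true by lia.
  by rewrite /= s5 // addnC.
split=> //=; first by rewrite /update /= l1 addn1.
move=> p; rewrite ltnS leq_eqVlt /update /= => /predU1P[->|p_k]; first by rewrite eqxx.
by rewrite (ltn_eqF p_k) o1.
Qed.

Definition total_init :=
  Seq (fset 6 ROne) (
  Seq (fset 7 RZero) (
  Seq (fset 8 (RAdd (RMul (RGet 4 zero) (rvar 2)) (RGet 5 zero)))
      (iset 10 zero))).

Definition total_tail :=
  Seq (RSet 4 (nvar 0) ROne) (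
  Seq (RSet 5 (nvar 0) RZero) (
  Seq (for_loop suffix_body) (
  Seq total_init (
  Seq (for_loop scan_body) (for_loop output_body))))).

Definition total_tail_cost :=
  wcost (RSet 4 (nvar 0) ROne) + (
  wcost (RSet 5 (nvar 0) RZero) + (
  3 + n.+1 * (wcost suffix_body + 13) + (
  wcost total_init + (
  3 + n.+1 * (wcost scan_body + 13) + (
  3 + n.+1 * (wcost output_body + 13)))))).

Definition total_spec st := exists2 m,
  forall j, (value (rot j s) <= value (rot m s))%R &
  forall p, p < n -> nmem st 1 p = nth 0 (rot m s) p.

Lemma halts_total_tail st : sorted_store st ->
  halts total_tail st total_tail_cost total_spec.
Proof.
move=> ss; have sz := sorted_store_size ss; have [[n0 _ _ _] _ _ _] := ss.
do 2!apply: halts_run_seq => //.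
apply: (@halts_seq _ _ _ _ _ _ (suffix_inv n)).
  apply: halts_suffix.
    by apply: (sorted_store_frame ss) => // -[|[|[|]]].
  by rewrite /suffix_values drop_oversize ?sz // scale_nil shift_nil /= /update /= n0 eqxx.
move=> st1 [ss1 _ sv1]; apply: halts_run_seq => //.
have {}sv1 m : m <= n -> suffix_values st1 m.
  by move=> m_n; apply: sv1; rewrite subnn.
apply: (@halts_seq _ _ _ _ _ _ (scan_inv n)).
  apply: halts_scan => //.
  have [q4 q5] := sv1 0 (leq0n _); have [[_ _ _ c1] _ _ _] := ss1.
  by rewrite /= /update /= q4 q5 c1 drop0 lin_seqE.
move=> st2 [ss2 _ _ _ [m_n m8 m0 mj]].
apply: halts_weaken (halts_output ss2 erefl m_n) _ _ => // st3 [_ _ _ o3].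
exists (nmem st2 10 0) => // j; rewrite -m8.
case: (ltnP j n) => [/mj //|n_j]; by rewrite rot_oversize ?sz.
Qed.

End Selection.

(** * Greedy selection *)

Section Greedy.
Variable R : realType.
Implicit Types st : store R.
Variables (n : nat) (A B : nat -> R) (c : R) (s : seq nat).

Local Notation sorted_store := (sorted_store n A B c s).
Local Notation value := (lin_seq A B c).

(* Rejected indices are stored from the end of the output array. *)
Definition greedy_body :=
  Seq (iset 8 (NGet 5 (nvar 6))) (
  Seq (fset 7 (RAdd (RMul (RGet 0 (nvar 8)) (rvar 6)) (RGet 1 (nvar 8))))
  (If (RLe (rvar 7) (rvar 6))
     (Seq (NSet 1 (NSub (NSub (nvar 0) one) (nvar 9)) (nvar 8)) (incr 9))
     (Seq (NSet 1 (nvar 2) (nvar 8)) (Seq (incr 2) (fset 6 (rvar 7)))))).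

Definition greedy_inv k st := [/\ sorted_store st, nmem st 6 0 = k &
  exists (sel rej : seq nat), [/\ perm_eq (sel ++ rej) (take k s),
    rmem st 6 0 = value sel /\ rmem st 6 0 = step_seq A B c (take k s),
    nmem st 2 0 = size sel /\ nmem st 9 0 = size rej,
    forall p, p < size sel -> nmem st 1 p = nth 0 sel p &
    forall p, p < size rej -> nmem st 1 (n - 1 - p) = nth 0 rej p]].

Lemma halts_greedy st : sorted_store st -> rmem st 6 0 = c ->
  nmem st 2 0 = 0 -> nmem st 9 0 = 0 ->
  halts (for_loop greedy_body) st (3 + n.+1 * (wcost greedy_body + 13)) (greedy_inv n).
Proof.
move=> ss e6 e2 e9; apply: halts_for.
- by split=> //; exists [::], [::]; rewrite take0; split.
- by move=> k st' [[[]]].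
move=> k st1 k_n [ss1 l1 [sel [rej [psr [v6 b6] [sz2 sz9] o1 o2]]]]; apply: halts_run => //.
have sz := sorted_store_size ss1.
have [[n1 A1 B1 c1] _ _ s5] := ss1.
(* As [k < n], the two ends of the output array have not met, so neither branch overwrites a stored
   index. *)
have szk : size sel + size rej = k.
  by rewrite -size_cat (perm_size psr) size_takel // sz ltnW.
set x := nth 0 s k.
have takeE : take k.+1 s = rcons (take k s) x by rewrite (take_nth 0) ?sz.
have stepE : step_seq A B c (take k.+1 s)
    = Num.max (rmem st1 6 0) (lin A B (rmem st1 6 0) x).
  by rewrite takeE /step_seq foldl_rcons -/(step_seq _ _ _ _) -b6.
rewrite /greedy_body !run_seq; set st2 := run _ (run _ st1).
have n2 : nmem st2 = update (nmem st1) 8 0 x by rewrite /= l1 s5.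
have r2 : rmem st2 = update (rmem st1) 7 0 (lin A B (rmem st1 6 0) x).
  by rewrite /= /update /= l1 s5 // A1 B1.
move: st2 n2 r2 => st2 n2 r2.
rewrite /= n2 r2 /update /= sz2 sz9 n1.
case: ifPn => le /=.
  split=> /=.
  - by apply: (sorted_store_frame ss1); rewrite /= ?n2 ?r2 // => -[|[|[|]]].
  - by rewrite l1 addn1.
  exists sel, (rcons rej x); split=> /=.
  - by rewrite takeE -rcons_cat -!cats1 perm_cat2r.
  - by rewrite /update /= v6; split=> //; rewrite stepE -v6; apply/esym/max_idPl.
  - by rewrite size_rcons /update /= sz2 addn1.
  - move=> p p_lt; rewrite /update /=; have -> : (p == n - 1 - size rej) = false by lia.
    exact: o1.
  - move=> p; rewrite size_rcons ltnS leq_eqVlt nth_rcons /update /=.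
    move=> /predU1P[->|p_lt]; first by rewrite !eqxx ltnn.
    have -> : (n - 1 - p == n - 1 - size rej) = false by lia.
    by rewrite p_lt o2.
split=> /=.
- by apply: (sorted_store_frame ss1); rewrite /= ?n2 ?r2 // => -[|[|[|]]].
- by rewrite l1 addn1.
exists (rcons sel x), rej; split=> /=.
- rewrite takeE cat_rcons perm_catC /= perm_sym perm_rcons perm_cons perm_sym.
  by rewrite perm_catC.
- rewrite stepE /lin_seq foldl_rcons -/(lin_seq _ _ _ _) -v6; split=> //.
  by apply/esym/max_idPr; rewrite leNgt; apply: contra le => /ltW.
- by rewrite size_rcons /update /= sz9 addn1.
- move=> p; rewrite size_rcons ltnS leq_eqVlt nth_rcons /update /=.
  move=> /predU1P[->|p_lt]; first by rewrite !eqxx ltnn.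
  by rewrite (ltn_eqF p_lt) p_lt o1.
- move=> p p_lt; rewrite /update /=; have -> : (n - 1 - p == size sel) = false by lia.
  exact: o2.
Qed.

Definition greedy_init := Seq (fset 6 (rvar 2)) (Seq (iset 2 zero) (iset 9 zero)).

Definition partial_spec st := exists l, [/\ perm_eq l (iota 0 n),
  forall p, p < n -> nmem st 1 p = nth 0 l p,
  nmem st 2 0 <= n & value (take (nmem st 2 0) l) = step_seq A B c s].

Lemma halts_partial_tail st : sorted_store st ->
  halts (Seq greedy_init (for_loop greedy_body)) st
    (wcost greedy_init + (3 + n.+1 * (wcost greedy_body + 13))) partial_spec.
Proof.
move=> ss; have sz := sorted_store_size ss; have [[_ _ _ c0] ps _ _] := ss.
apply: halts_run_seq => //; apply: halts_weaken (halts_greedy _ _ _ _) _ _ => //.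
move=> st1 [_ _ [sel [rej [psr [v6 b6] [sz2 sz9] o1 o2]]]].
rewrite take_oversize ?sz // in psr b6.
have szn : size sel + size rej = n by rewrite -size_cat (perm_size psr).
(* Filling from the end puts the rejected indices in reverse order. *)
exists (sel ++ rev rej); split.
- by apply: perm_trans ps; apply: perm_trans psr; rewrite perm_cat2l perm_rev.
- move=> p p_n; rewrite nth_cat; case: ltnP => p_sel; first exact: o1.
  rewrite nth_rev; last by lia.
  rewrite -o2; last by lia.
  by congr (nmem _ _ _); lia.
- by rewrite sz2; lia.
- by rewrite sz2 take_size_cat // -v6 b6.
Qed.

End Greedy.

(** * Running time and correctness *)

(** The range starts at 2 because [trunc_log 2] vanishes at 0 and 1. *)
Definition nlogn_bounded (f : nat -> nat) :=
  exists C, forall n, 1 < n -> f n <= C * (n * trunc_log 2 n).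

Lemma nlogn_boundedD f g : nlogn_bounded f -> nlogn_bounded g ->
  nlogn_bounded (fun n => f n + g n).
Proof.
move=> [C hC] [D hD]; exists (C + D) => n n1.
by rewrite mulnDl leq_add ?hC ?hD.
Qed.

Lemma trunc_log_gt0 n : 1 < n -> 0 < trunc_log 2 n.
Proof. by move=> n1; apply: trunc_log_max. Qed.

Lemma nlogn_bounded_cst k : nlogn_bounded (fun=> k).
Proof.
exists k => n n1; rewrite -[leqLHS]muln1 leq_mul2l muln_gt0 trunc_log_gt0 //.
by rewrite (ltnW n1) orbT.
Qed.

Lemma nlogn_bounded_loop k : nlogn_bounded (fun n => n.+1 * (k + 13)).
Proof.
exists (2 * (k + 13)) => n n1; rewrite mulnC -mulnA mulnCA.
rewrite leq_mul2l; apply/orP; right.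
apply: leq_trans (_ : 2 * (n * 1) <= _); first by lia.
by rewrite !leq_mul2l /= trunc_log_gt0 ?orbT.
Qed.

Lemma nlogn_bounded_sift k : nlogn_bounded (fun n => n.+1 * (k + sift_cost (height n) + 13)).
Proof.
rewrite /sift_cost; move: (_.+1) => w.
(* The factors come from [n.+1 <= 2 * n] and [L.+2 <= 3 * L], where [L] is the logarithm. *)
exists (2 * (k + 3 * w + 13)) => n n1; rewrite /height addn1.
have L1 := trunc_log_gt0 n1; move: (trunc_log 2 n) L1 => L L1.
have le1 : k + L.+2 * w + 13 <= (k + 3 * w + 13) * L.
  rewrite 2!mulnDl; apply: leq_add; last by lia.
  apply: leq_add; first by rewrite leq_pmulr.
  by rewrite mulnAC leq_mul2r; apply/orP; right; lia.
apply: leq_trans (leq_mul (_ : n.+1 <= 2 * n) le1) _; first by lia.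
by rewrite mulnACA.
Qed.

Lemma nlogn_bounded_sort : nlogn_bounded sort_cost.
Proof.
apply: nlogn_boundedD; first apply: nlogn_boundedD.
- exact: nlogn_bounded_cst.
- exact: nlogn_bounded_loop.
apply: nlogn_boundedD; first apply: nlogn_boundedD.
- exact: nlogn_bounded_cst.
- exact: nlogn_bounded_sift.
apply: nlogn_boundedD; first exact: nlogn_bounded_cst.
exact: nlogn_bounded_sift.
Qed.

From mathcomp Require Import boolp classical_sets topology normedtype landau exp.
Import numFieldNormedType.Exports.

Section BigO.
Variable R : realType.
Local Open Scope classical_set_scope.
Local Open Scope ring_scope.

Lemma trunc_log_ln n : (0 < n)%N -> (trunc_log 2 n)%:R * ln 2 <= ln n%:R :> R.
Proof.
move=> n_gt0; rewrite mulr_natl -lnXn ?ltr0n // ler_ln ?posrE ?exprn_gt0 ?ltr0n //.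
by rewrite -natrX ler_nat trunc_logP.
Qed.

Lemma nlogn_bounded_bigO f : nlogn_bounded f ->
  (fun n => (f n)%:R : R) =O_\oo (@n_log_n R).
Proof.
move=> [C hC]; have ln2_gt0 : 0 < ln 2 :> R by rewrite ln_gt0 // ltr1n.
(* The added 1 keeps the constant positive even when [C] is 0. *)
apply/eqO_exP; exists (C%:R / ln 2 + 1).
  by rewrite ltr_wpDl // divr_ge0 ?ler0n // ltW.
exists 2%N => // n /= n2; rewrite /n_log_n.
have n_gt0 : (0 < n)%N by exact: leq_trans n2.
have ln_ge0 : 0 <= ln n%:R :> R by rewrite ln_ge0 // ler1n.
rewrite ger0_norm ?ler0n // ger0_norm ?mulr_ge0 ?ler0n //.
apply: (@le_trans _ _ (C%:R / ln 2 * (n%:R * ln n%:R))); last first.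
  by rewrite ler_wpM2r ?mulr_ge0 ?ler0n // lerDl.
apply: (@le_trans _ _ (C%:R * (n%:R * (trunc_log 2 n)%:R))).
  by rewrite -!natrM ler_nat hC.
rewrite -!mulrA ler_wpM2l ?ler0n // mulrCA ler_wpM2l ?ler0n //.
by rewrite mulrC ler_pdivlMr // trunc_log_ln.
Qed.

End BigO.

(** * From stored index lists back to permutations *)

Section Answers.
Variable R : realType.
Implicit Types x : instance R.

Definition image_seq n (s : 'S_n) : seq nat := [seq val (s i) | i <- enum 'I_n].

Lemma perm_image_seq n (s : 'S_n) : perm_eq (image_seq s) (iota 0 n).
Proof.
rewrite -val_enum_ord /image_seq (map_comp val s); apply: perm_map.
apply: uniq_perm; [|exact: enum_uniq|].
  by rewrite map_inj_uniq ?enum_uniq //; exact: perm_inj.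
move=> i; rewrite mem_enum; apply/mapP; exists ((s^-1)%g i).
  by rewrite mem_enum.
by rewrite permKV.
Qed.

Lemma image_seqP n (l : seq nat) : perm_eq l (iota 0 n) ->
  exists s : 'S_n, image_seq s = l /\ forall i : 'I_n, s i = nth 0 l i :> nat.
Proof.
move=> pl; have sz : size l = n by rewrite (perm_size pl) size_iota.
have lt (i : 'I_n) : nth 0 l i < n.
  have : nth 0 l i \in l by rewrite mem_nth ?sz.
  by rewrite (perm_mem pl) mem_iota.
have inj : injective (fun i : 'I_n => Ordinal (lt i)).
  move=> i j /(congr1 val) /= /eqP; rewrite nth_uniq ?sz // => [/eqP/val_inj //|].
  by rewrite (perm_uniq pl) iota_uniq.
exists (perm inj); split; last by move=> i; rewrite permE.
apply: (@eq_from_nth _ 0); rewrite size_map size_enum_ord ?sz // => i i_n.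
by rewrite (nth_map (Ordinal i_n)) ?size_enum_ord // permE /= nth_enum_ord.
Qed.

Lemma comp_valueE x (s : 'S_(arity x)) k :
  comp_value (@linear_fun R x) s k (start x) =
  lin_seq (cells (@slope R x)) (cells (@intercept R x)) (start x) (take k (image_seq s)).
Proof.
rewrite /comp_value /lin_seq /image_seq -map_take.
move: (take k _) (start x) => l; elim: l => //= i l IH y.
by rewrite IH; congr foldl; rewrite /linear_fun /lin /cells valK.
Qed.

(** The exchange arguments take slopes on all natural numbers; the default 0 of [cells] keeps them
    nonnegative out of range. *)
Lemma cells_ge0 x : nondecreasing_slopes x -> forall i, (0 <= cells (@slope R x) i)%R.
Proof. by move=> nd i; rewrite /cells; case: insubP => [j _ _|_]; rewrite ?nd. Qed.

Lemma input_load x : input (arity x) (cells (@slope R x)) (cells (@intercept R x))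
  (start x) (load_instance x).
Proof. by []. Qed.

End Answers.

Theorem theorem1 (R : realType) :
  solvable_in_time (@arity R) (@load_instance R) (@nondecreasing_slopes R)
    (@answer_partial R) (@n_log_n R) /\
  solvable_in_time (@arity R) (@load_instance R) (@nondecreasing_slopes R)
    (@answer_total R) (@n_log_n R).
Proof.
split.
- exists (Seq sort_program (Seq greedy_init (for_loop greedy_body))).
  exists (fun n => sort_cost n +
    (wcost greedy_init + (3 + n.+1 * (wcost greedy_body + 13)))); split.
    apply: nlogn_bounded_bigO; apply: nlogn_boundedD; first exact: nlogn_bounded_sort.
    apply: nlogn_boundedD; first exact: nlogn_bounded_cst.
    apply: nlogn_boundedD; first exact: nlogn_bounded_cst.
    exact: nlogn_bounded_loop.
  move=> x nd; set A := cells (@slope R x); set B := cells (@intercept R x).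
  have A_ge0 := cells_ge0 nd; set n := arity x.
  suff [t [st [e le ans]]] : halts (Seq sort_program (Seq greedy_init (for_loop greedy_body)))
      (load_instance x) (sort_cost n +
      (wcost greedy_init + (3 + n.+1 * (wcost greedy_body + 13)))) (@answer_partial R x).
    by exists t, st.
  apply: halts_seq (halts_sort (input_load x) _) _ => // st [s ss].
  have [_ ps srt _] := ss.
  apply: halts_weaken (halts_partial_tail ss) _ _ => // st1 [l [pl o1 k_n vl]].
  have [p [pE pl_nth]] := image_seqP pl.
  exists p; split; first by move=> i; rewrite pl_nth o1.
  split=> // p' k' _; rewrite !comp_valueE pE vl.
  (* Any partial value is at most the greedy value along its own full order, and that is at most the
     greedy value along [s]. *)
  apply: le_trans (lin_seq_take_le B A_ge0 _ _ _) _.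
  apply: (step_seq_sorted A_ge0 _ srt); apply: perm_trans (perm_image_seq p') _.
  by rewrite perm_sym.
- exists (Seq sort_program total_tail), (fun n => sort_cost n + total_tail_cost n); split.
    apply: nlogn_bounded_bigO; apply: nlogn_boundedD; first exact: nlogn_bounded_sort.
    do ![apply: nlogn_boundedD | exact: nlogn_bounded_cst | exact: nlogn_bounded_loop].
  move=> x nd; set A := cells (@slope R x); set B := cells (@intercept R x).
  have A_ge0 := cells_ge0 nd; set n := arity x.
  suff [t [st [e le ans]]] : halts (Seq sort_program total_tail)
      (load_instance x) (sort_cost n + total_tail_cost n) (@answer_total R x).
    by exists t, st.
  apply: halts_seq (halts_sort (input_load x) _) _ => // st [s ss].
  have [_ ps srt _] := ss.
  apply: halts_weaken (halts_total_tail ss) _ _ => // st1 [m mx o1].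
  have us : uniq s by rewrite (perm_uniq ps) iota_uniq.
  have [j [_ opt]] := optimal_rotation A_ge0 us srt.
  have [|p [pE p_nth]] := @image_seqP n (rot m s).
    by apply: perm_trans ps; rewrite perm_rot.
  exists p; split; first by move=> i; rewrite p_nth o1.
  move=> p'; rewrite !comp_valueE pE take_oversize; last first.
    by rewrite size_map size_enum_ord.
  rewrite take_oversize; last by rewrite size_rot (perm_size ps) size_iota.
  (* The selected rotation is at least as good as the optimal rotation [j]; equal slopes reduce the
     remaining comparison to shifts. *)
  apply: le_trans (mx j); rewrite !lin_seqE.
  have ps' : perm_eq (image_seq p') s.
    by apply: perm_trans (perm_image_seq p') _; rewrite perm_sym.
  rewrite (perm_scale _ (_ : perm_eq (rot j s) s)) ?perm_rot //.
  by rewrite (perm_scale _ ps') lerD2l opt.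
Qed.
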